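(* For every integer $w \geq 1$, every planar poset $P$ of width $w$ satisfies $\operatorname{qn}(P) \leq 3w-2$. Moreover, for every integer $w\geq 1$ there is a planar poset of width $w$ whose queue-number is equal to $w$.
   Context: All posets are finite and nonempty. For elements $a,b$ of a poset $P$, write $a \prec b$ (a cover relation, or cover) if $a<b$ and there is no $c\in P$ with $a<c<b$. The width of $P$ is the maximum number of pairwise incomparable elements. A linear extension $L$ of $P$ is a linear order on the elements of $P$ such that $x<_L y$ whenever $x<_P y$. A rainbow of size $k$ (a $k$-rainbow) with respect to $L$ is a set of $k$ covers $a_1\prec b_1,\dots,a_k\prec b_k$ of $P$ with $a_1<_L\cdots<_L a_k<_L b_k<_L\cdots<_L b_1$. The queue-number $\operatorname{qn}(P)$ is the smallest $k$ such that there is a linear extension $L$ of $P$ with respect to which the covers of $P$ contain no $(k+1)$-rainbow. A diagram of $P$ represents the elements as distinct points in the plane and each cover $a\prec b$ as a $y$-monotone curve going upwards from $a$ to $b$ (not passing through points of other elements). A poset is planar if it admits a crossing-free diagram, i.e. one in which distinct curves meet only in common endpoints. *)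

(* Defs.v *)
From HB Require Import structures.
From mathcomp Require Import all_boot all_order all_algebra.
From mathcomp Require Import all_classical all_reals all_analysis.
Set Implicit Arguments.
Unset Strict Implicit.
Unset Printing Implicit Defensive.
Import Order.TTheory GRing.Theory Num.Theory.
Import numFieldNormedType.Exports.

Definition cover_rel (d : Order.disp_t) (T : finPOrderType d) (a b : T) : bool :=
  (a < b)%O && ~~ [exists c : T, (a < c)%O && (c < b)%O].

Definition antichain (d : Order.disp_t) (T : finPOrderType d) (A : {set T}) : bool :=
  [forall x in A, forall y in A, (x != y) ==> (x >< y)%O].

Definition width (d : Order.disp_t) (T : finPOrderType d) : nat :=
  \max_(A : {set T} | antichain A) #|A|.

(* Linear orders are given by their reflexive relation (totality includes
   reflexivity); this is the associated strict order. *)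
Definition strict_rel (T : eqType) (L : rel T) : rel T :=
  fun x y => (x != y) && L x y.

Definition linear_extension (d : Order.disp_t) (T : finPOrderType d)
    (L : rel T) : Prop :=
  [/\ total L, antisymmetric L, transitive L &
      forall x y : T, (x < y)%O -> strict_rel L x y].

(* The list (a_1, b_1), ..., (a_k, b_k) of covers is nested:
   a_1 <_L ... <_L a_k <_L b_k <_L ... <_L b_1. *)
Definition is_rainbow (d : Order.disp_t) (T : finPOrderType d)
    (L : rel T) (s : seq (T * T)) : bool :=
  all (fun c => cover_rel c.1 c.2) s &&
  sorted (strict_rel L) ([seq c.1 | c <- s] ++ rev [seq c.2 | c <- s]).

Definition has_rainbow (d : Order.disp_t) (T : finPOrderType d)
    (L : rel T) (k : nat) : Prop :=
  exists s : seq (T * T), size s = k /\ is_rainbow L s.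

Definition queue_layout (d : Order.disp_t) (T : finPOrderType d) (k : nat) : Prop :=
  exists L : rel T, linear_extension L /\ ~ has_rainbow L k.+1.

Lemma linear_extension_exists (d : Order.disp_t) (T : finPOrderType d) :
  exists L : rel T, linear_extension L.
Proof.
pose h (x : T) := #|[set z : T | (z <= x)%O]|.
pose key (x : T) := (h x * #|T| + enum_rank x)%N.
have inj : injective key.
  move=> x y; rewrite /key => e; apply: enum_rank_inj; apply: val_inj => /=.
  by have := congr1 (fun n => n %% #|T|) e; rewrite /= !modnMDl !modn_small.
exists (fun x y => key x <= key y)%N; split.
- by move=> x y; exact: leq_total.
- by move=> x y; rewrite -eqn_leq => /eqP /inj.
- by move=> y x z; exact: leq_trans.
- move=> x y xy; rewrite /strict_rel (lt_eqF xy) /=.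
  have hxy : (h x < h y)%N.
    apply: proper_card; apply/properP; split.
      by apply/fintype.subsetP => z; rewrite !inE => /le_trans; apply; exact: ltW.
    by exists y; rewrite !inE ?lexx // lt_geF.
  apply: ltnW; rewrite /key.
  have lt : (h x * #|T| + enum_rank x < (h x).+1 * #|T|)%N.
    by rewrite mulSn addnC ltn_add2r.
  apply: leq_trans lt _; apply: leq_trans (leq_addr _ _).
  by rewrite leq_mul2r hxy orbT.
Qed.

Lemma queue_layout_exists (d : Order.disp_t) (T : finPOrderType d) :
  exists k : nat, `[< queue_layout T k >].
Proof.
have [L HL] := linear_extension_exists T; have [_ anti tr _] := HL.
exists #|T|; apply/asboolP; exists L; split=> // -[s [ss /andP[_ so]]].
have tr' : transitive (strict_rel L).
  move=> y x z /andP[xy Lxy] /andP[yz Lyz]; apply/andP; split; last exact: tr Lyz.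
  by apply: contra_neq xy => exz; apply: anti; rewrite Lxy exz Lyz.
have : uniq [seq c.1 | c <- s].
  have irr : irreflexive (strict_rel L) by move=> x; rewrite /strict_rel eqxx.
  by have := sorted_uniq tr' irr so; rewrite cat_uniq => /and3P[].
move/card_uniqP; rewrite size_map ss => e.
by have := max_card [in [seq c.1 | c <- s]]; rewrite e ltnn.
Qed.

Definition queue_number (d : Order.disp_t) (T : finPOrderType d) : nat :=
  ex_minn (queue_layout_exists T).

Section Planarity.
Local Open Scope classical_set_scope.
Local Open Scope ring_scope.

(* A curve in the plane R * R parametrized by [0, 1]; the second coordinate is
   the height. *)
Definition upward_curve (R : realType) (p q : R * R) (g : R -> R * R) : Prop :=
  [/\ {within `[0, 1], continuous g}, g 0 = p, g 1 = q &
      {in `[0, 1] &, forall s t : R, s < t -> (g s).2 < (g t).2}].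

(* pos places the elements; g a b is only relevant when a is covered by b. *)
Definition diagram (R : realType) (d : Order.disp_t) (T : finPOrderType d)
    (pos : T -> R * R) (g : T -> T -> R -> R * R) : Prop :=
  injective pos /\
  forall a b : T, cover_rel a b ->
    upward_curve (pos a) (pos b) (g a b) /\
    {in `[0, 1], forall (t : R) (v : T), g a b t = pos v -> v = a \/ v = b}.

Definition crossing_free (R : realType) (d : Order.disp_t) (T : finPOrderType d)
    (pos : T -> R * R) (g : T -> T -> R -> R * R) : Prop :=
  forall a b a' b' : T, cover_rel a b -> cover_rel a' b' -> (a, b) <> (a', b') ->
  {in `[0, 1] &, forall s t : R, g a b s = g a' b' t ->
    exists v : T, [/\ v = a \/ v = b, v = a' \/ v = b' & g a b s = pos v]}.

Definition planar (R : realType) (d : Order.disp_t) (T : finPOrderType d) : Prop :=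
  exists (pos : T -> R * R) (g : T -> T -> R -> R * R),
    diagram pos g /\ crossing_free pos g.

End Planarity.

(* Main.v *)
From HB Require Import structures.
Require Import Defs.
From mathcomp Require Import all_boot all_order all_algebra.
From mathcomp Require Import all_classical all_reals all_analysis.
From mathcomp Require Import zify ring lra.

Set Implicit Arguments.
Unset Strict Implicit.
Unset Printing Implicit Defensive.
Import Order.TTheory GRing.Theory Num.Theory.
Import numFieldNormedType.Exports.

(** Fix a crossing-free upward drawing and sweep it from bottom to top; vertices
    at the same height are swept from left to right. The only trace of the
    geometry that the argument uses is the relation saying which of two objects
    (vertices or edges) met by the sweep line at the same time is on the left;
    [leftrel_leftness] extracts it with the intermediate value theorem.

    Every upper bound comes from two linear extensions L and R of the poset,
    left-first and right-first, built by inserting the objects in the order of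
    the sweep. L places a vertex right after its rightmost incoming edge and an
    edge right after its tail; R is the mirror image. A source that the sweep
    meets between two edges is hung onto the one with the earlier tail, and this
    tail is called its foot; other sources have no foot. The intersection Q of L and R is a
    partial order extending the given one, so its antichains have at most w
    elements, and two Q-incomparable objects are related by a second partial
    order, being to the left of. Edges stay tied to their ends in Q: what
    lies above an edge is its head or lies above it, what lies below an edge is
    its tail or lies below it ([edge_below], [below_edge]). It follows that a
    Q-chain cannot cross an edge ([edge_separates]).

    Lay out the elements in the order L and take a rainbow. Call a cover
    bypassed when it is no longer a cover of Q.
    - The covers of the rainbow that are not bypassed yield an antichain of Q
      with one end of each ([nests_antichain]), so there are at most w of them.
    - A bypassed cover starts at the foot of some source, or ends at the roof of
      some sink, the vertex that closes the region in which the sink lies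
      ([bypassed_charge]). A source has at most one foot, a sink at most one
      roof, and the covers of a rainbow have distinct ends. The lowest vertex has no foot and
      the highest has no roof, so at most (sources - 1) + (sinks - 1) covers of
      the rainbow are bypassed.
    Sources and sinks are antichains, and w + 2 (w - 1) = 3 w - 2.

    The same bound gives queue-number at most w for a planar poset with a
    minimum and a maximum. In [tower], two copies of a poset, one below the
    other, stand beside one more element between a common bottom and a common
    top. In every linear extension the extra element comes after all of the
    lower copy or before all of the upper one, so one of its two covers wraps
    the forced rainbow of a copy: each step raises both the width and the size
    of the forced rainbow by one. *)

(** * The left-to-right relation of a sweep *)

Lemma exists_maximal (T : finType) (P : pred T) (R : rel T) (x0 : T) :
  irreflexive R ->
  (forall x y z, P x -> P y -> P z -> R x y -> R y z -> R x z) -> P x0 ->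
  exists2 m, P m & forall x, P x -> ~~ R m x.
Proof.
move=> irr tr Px0.
pose below x := [set y | P y && R y x].
case: (@arg_maxnP T x0 P (fun x => #|below x|) Px0) => m Pm max_m.
exists m => // x Px; apply/negP => Rmx.
suff : #|below m| < #|below x| by rewrite ltnNge => /negP[]; apply: max_m.
apply: proper_card; apply/properP; split.
  apply/fintype.subsetP => y; rewrite !inE => /andP[Py Rym].
  by rewrite Py (tr y m x).
by exists m; rewrite !inE Pm ?Rmx ?irr.
Qed.

Section Sweep.
Variables (V E : finType) (tl hd : E -> V) (r : V -> nat).

Notation O := (V + E)%type.
Implicit Types (x y z o w : O) (e f g : E) (u v t : V).

(** Times of the sweep: a vertex is met at an even time, an edge at all times
    strictly between those of its ends. So an edge does not overlap its ends,
    and two distinct vertices never overlap. *)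
Definition start o := match o with inl v => (r v).*2 | inr e => (r (tl e)).*2.+1 end.
Definition stop o := match o with inl v => (r v).*2 | inr e => (r (hd e)).*2.-1 end.
Definition overlap x y := (start x <= stop y) && (start y <= stop x).

Ltac slia := repeat match goal with x := _ |- _ => subst x end;
  unfold overlap, start, stop in *; simpl in *; lia.

Definition converse (R : rel O) : rel O := fun x y => R y x.

(** The last four fields say that an edge has at its ends the neighbours on the
    left and on the right that its end has: nothing else crosses there. *)
Record leftness (lf : rel O) : Prop := Leftness {
  rank_inj : injective r;
  rank_edge : forall e, r (tl e) < r (hd e);
  lf_overlap : forall x y, lf x y -> overlap x y;
  lf_total : forall x y, x != y -> overlap x y -> lf x y || lf y x;
  lf_asym : forall x y, lf x y -> ~~ lf y x;
  lf_trans : forall x y z, lf x y -> lf y z -> overlap x z -> lf x z;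
  lf_tl : forall e o, lf o (inl (tl e)) -> lf o (inr e);
  tl_lf : forall e o, lf (inl (tl e)) o -> lf (inr e) o;
  lf_hd : forall e o, lf o (inl (hd e)) -> lf o (inr e);
  hd_lf : forall e o, lf (inl (hd e)) o -> lf (inr e) o }.

Lemma overlapC x y : overlap x y = overlap y x.
Proof. by rewrite /overlap andbC. Qed.

Lemma leftness_flip lf : leftness lf -> leftness (converse lf).
Proof.
case=> inj re ov tot asym tr a b c d; split=> //.
- by move=> x y /ov; rewrite overlapC.
- by move=> x y xy /(tot _ _ xy); rewrite orbC.
- by move=> x y; apply: asym.
- by move=> x y z xy yz; rewrite overlapC => xz; apply: tr yz xy xz.
Qed.

(** The rightmost edge entering [v], if there is one; for the converse relation,
    the leftmost one. *)
Definition last_in (lf : rel O) v : option E :=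
  [pick e | (hd e == v) && [forall f, (hd f == v) ==> ~~ lf (inr e) (inr f)]].
(** The edge immediately to the left of [v] when the sweep meets [v]; for the
    converse relation, the edge immediately to its right. *)
Definition left_nbr (lf : rel O) v : option E :=
  [pick e | lf (inr e) (inl v) &&
     [forall f, lf (inr f) (inl v) ==> ~~ lf (inr e) (inr f)]].

(** * Linear orders built by insertion *)

(** Where [y] is inserted among the objects that the sweep has met before it:
    right after the given object ([true]) or right before it ([false]); [None]
    stands for a virtual object before, respectively after, all the others. The
    predicate [s] selects the sources that are hung onto the edge on their left. *)
Definition anchor (lf : rel O) (s : pred V) (y : O) : bool * option O :=
  match y with
  | inr e => (true, Some (inl (tl e)))
  | inl v => if last_in lf v is Some e then (true, Some (inr e))
             else if s v then (true, omap inr (left_nbr lf v))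
             else (false, omap inr (left_nbr (converse lf) v))
  end.

Definition in_cut (lf : rel O) (s : pred V) (R : rel O) (y x : O) : bool :=
  match anchor lf s y with
  | (true, Some f) => (x == f) || R x f
  | (true, None) => false
  | (false, Some f) => R x f
  | (false, None) => true
  end.

(** Distinct objects with the same starting time are edges leaving one vertex. The
    fuel bounds the starting times. *)
Fixpoint ins_order_fuel (lf : rel O) (s : pred V) (n : nat) (x y : O) : bool :=
  if n is m.+1 then
    if start x < start y then in_cut lf s (ins_order_fuel lf s m) y x
    else if start y < start x then ~~ in_cut lf s (ins_order_fuel lf s m) x y
    else lf x y
  else false.

Definition ins_order lf s x y := ins_order_fuel lf s (maxn (start x) (start y)).+1 x y.

Section OneOrder.
Variable lf : rel O.
Hypothesis lfP : leftness lf.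
Let ov := lf_overlap lfP.

Lemma start_eq x y : start x = start y ->
  x = y \/ exists e f, [/\ x = inr e, y = inr f & tl e = tl f].
Proof.
case: x y => [u|e] [v|f] /=; try lia.
- by move/double_inj/(rank_inj lfP) => ->; left.
- by move=> /succn_inj/double_inj/(rank_inj lfP) h; right; exists e, f.
Qed.

Lemma edge_start e : start (inr e) < start (inl (hd e)).
Proof. by have := rank_edge lfP e => /=; lia. Qed.

Lemma start_stop x : start x <= stop x.
Proof. by case: x => [v|e] //=; have := rank_edge lfP e; lia. Qed.

Lemma lfxx x : lf x x = false.
Proof. by apply/negP => h; have := lf_asym lfP h; rewrite h. Qed.

Lemma lf_edge_vertex e v : overlap (inr e) (inl v) ->
  (r (tl e) < r v) && (r v < r (hd e)).
Proof. by rewrite /overlap /=; lia. Qed.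

Lemma edge_vertex_overlap e v :
  (r (tl e) < r v) && (r v < r (hd e)) -> overlap (inr e) (inl v).
Proof. by rewrite /overlap /=; lia. Qed.

Lemma last_inP v e0 : hd e0 = v ->
  exists e, [/\ last_in lf v = Some e, hd e = v &
     forall f, hd f = v -> f = e \/ lf (inr f) (inr e)].
Proof.
move=> he0.
have ovin e f : hd e = v -> hd f = v -> overlap (inr e) (inr f).
  move=> he hf; have := rank_edge lfP e; have := rank_edge lfP f.
  by rewrite /overlap /= he hf; lia.
have [|||m /eqP hm mmax] := @exists_maximal E (fun e => hd e == v)
  (fun e f => lf (inr e) (inr f)) e0.
- by move=> e; rewrite lfxx.
- move=> x y z /eqP hx /eqP hy /eqP hz xy yz.
  by apply: (lf_trans lfP) xy yz _; apply: ovin.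
- by apply/eqP.
rewrite /last_in; case: pickP => [e /andP[/eqP he /forallP emax]|/(_ m)]; last first.
  rewrite hm eqxx /= => /negbT/negP[]; apply/forallP => f; apply/implyP.
  exact: mmax.
exists e; split=> // f hf; have [->|fe] := eqVneq f e; first by left.
right; have := emax f; rewrite hf eqxx /= => /negPf ef.
have := lf_total lfP (_ : inr f != inr e :> O) (ovin _ _ hf he).
by rewrite ef orbF; apply.
Qed.

Lemma last_in_hd v e : last_in lf v = Some e -> hd e = v.
Proof. by rewrite /last_in; case: pickP => // f /andP[/eqP + _] [<-]. Qed.

Lemma last_in_max v e f : last_in lf v = Some e -> hd f = v ->
  f = e \/ lf (inr f) (inr e).
Proof.
by move=> re hf; have [e' []] := last_inP hf; rewrite re => -[<-] _; apply.
Qed.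

Lemma last_in_none v : last_in lf v = None -> forall e, hd e <> v.
Proof. by move=> rn e /last_inP[e' []]; rewrite rn. Qed.

Lemma left_nbr_lf v e : left_nbr lf v = Some e -> lf (inr e) (inl v).
Proof. by rewrite /left_nbr; case: pickP => // f /andP[+ _] [<-]. Qed.

Lemma left_edge o v : lf o (inl v) -> exists e, o = inr e.
Proof.
case: o => [u|e]; last by exists e.
move=> h; have := ov h; rewrite /overlap /= => uv.
suff uv' : u = v by move: h; rewrite uv' lfxx.
by apply: (rank_inj lfP); lia.
Qed.

Lemma cross_overlap e f v : overlap (inr e) (inl v) -> overlap (inr f) (inl v) ->
  overlap (inr e) (inr f).
Proof. by rewrite /overlap /=; lia. Qed.

Lemma left_nbrP v e : lf (inr e) (inl v) ->
  exists f, [/\ left_nbr lf v = Some f, lf (inr f) (inl v) &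
    forall g, lf (inr g) (inl v) -> g = f \/ lf (inr g) (inr f)].
Proof.
move=> hev.
have ovin g f : lf (inr g) (inl v) -> lf (inr f) (inl v) -> overlap (inr g) (inr f).
  by move=> /ov hg /ov hf; apply: cross_overlap hf.
have [|||m hm mmax] := @exists_maximal E (fun e => lf (inr e) (inl v))
  (fun e f => lf (inr e) (inr f)) e.
- by move=> x; rewrite lfxx.
- by move=> x y z hx hy hz xy yz; apply: (lf_trans lfP) xy yz _; apply: ovin.
- by [].
rewrite /left_nbr; case: pickP => [f /andP[hf fmax]|/(_ m)]; last first.
  rewrite hm /= => /negbT/negP[]; apply/forallP => g; apply/implyP.
  exact: mmax.
exists f; split=> // g hg; have [->|gf] := eqVneq g f; first by left.
right; have := forallP fmax g; rewrite hg /= => /negPf fg.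
have := lf_total lfP (_ : inr g != inr f :> O) (ovin _ _ hg hf).
by rewrite fg orbF; apply.
Qed.

End OneOrder.

Lemma anchor_start lf s y b o : leftness lf ->
  anchor lf s y = (b, Some o) -> start o < start y.
Proof.
move=> lfP; case: y => [v|e] /=; last by case=> _ <- /=; lia.
case re : (last_in lf v) => [e|].
  by case=> _ <-; have := edge_start lfP e; rewrite (last_in_hd re).
have lfP' := leftness_flip lfP.
case: (s v) => -[_].
  case nv: (left_nbr lf v) => [e|//] [<-].
  by have /(lf_overlap lfP)/lf_edge_vertex /= := left_nbr_lf nv; lia.
case nv: (left_nbr (converse lf) v) => [e|//] [<-].
by have /(lf_overlap lfP')/lf_edge_vertex /= := left_nbr_lf nv; lia.
Qed.

Section Linear.
Variables (lf : rel O) (s : pred V).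
Hypothesis lfP : leftness lf.
Local Notation L := (ins_order lf s).

Lemma cut_ext y x n (R R' : rel O) : start y <= n -> start x < n ->
  (forall a b, start a < n -> start b < n -> R a b = R' a b) ->
  in_cut lf s R y x = in_cut lf s R' y x.
Proof.
move=> yn xn RR'; rewrite /in_cut; case a: (anchor lf s y) => [b [f|]] //.
have fn : start f < n by apply: leq_trans yn; apply: anchor_start a.
by rewrite RR'.
Qed.

Lemma ins_order_fuelE n m x y : maxn (start x) (start y) < n -> maxn (start x) (start y) < m ->
  ins_order_fuel lf s n x y = ins_order_fuel lf s m x y.
Proof.
elim: n m x y => [|n IH] [|m] x y //= hn hm.
have ext a b : (start a < maxn (start x) (start y)) ->
   (start b < maxn (start x) (start y)) -> ins_order_fuel lf s n a b = ins_order_fuel lf s m a b.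
  by move=> ha hb; apply: IH; lia.
case: ltnP => [xy|yx]; first by apply: cut_ext ext; lia.
by case: ltnP => // xy; congr (~~ _); apply: cut_ext ext; lia.
Qed.

Lemma ord_early x y : start x < start y -> L x y = in_cut lf s L y x.
Proof.
move=> xy; rewrite {1}/ins_order /= xy.
by apply: (@cut_ext _ _ (start y)) => // a b ha hb; apply: ins_order_fuelE; lia.
Qed.

Lemma ord_late x y : start y < start x -> L x y = ~~ in_cut lf s L x y.
Proof.
move=> yx; rewrite {1}/ins_order /= yx ltnNge (ltnW yx) /=; congr (~~ _).
by apply: (@cut_ext _ _ (start x)) => // a b ha hb; apply: ins_order_fuelE; lia.
Qed.

Lemma ord_same x y : start x = start y -> L x y = lf x y.
Proof. by move=> xy; rewrite /ins_order /= xy ltnn. Qed.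

Lemma ordxx x : L x x = false.
Proof. by rewrite ord_same // lfxx. Qed.

Lemma ordNC x y : x != y -> L x y = ~~ L y x.
Proof.
move=> xy; case: (ltngtP (start x) (start y)) => h.
- by rewrite (ord_early h) (ord_late h) negbK.
- by rewrite (ord_early h) (ord_late h).
rewrite !ord_same //.
have [exy|[e [f [ex ey ef]]]] := start_eq lfP h; first by rewrite exy eqxx in xy.
have oxy : overlap x y.
  have := rank_edge lfP e; have := rank_edge lfP f.
  by rewrite /overlap ex ey /= ef; lia.
have := lf_total lfP xy oxy; case lxy: (lf x y) => /=; last by move->.
by rewrite (negPf (lf_asym lfP lxy)).
Qed.

Lemma cut_same x y : start x = start y -> in_cut lf s L x =1 in_cut lf s L y.
Proof.
move=> h z; have [->//|[e [f [-> -> ef]]]] := start_eq lfP h.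
by rewrite /in_cut /= ef.
Qed.

Lemma ord_trans y x z : L x y -> L y z -> L x z.
Proof.
have [n] := ubnP (maxn (maxn (start x) (start y)) (start z)).
elim: n x y z => // n IH x y z hn.
have down o a b : start a < start o -> start b < start o -> start o <= n ->
    L a b -> in_cut lf s L o b -> in_cut lf s L o a.
  move=> ha hb ho ab; rewrite /in_cut; case an: (anchor lf s o) => [[] [f|]] //.
    have hf := anchor_start lfP an.
    case/predU1P => [<-|bf]; first by rewrite ab orbT.
    by rewrite (IH a b f) ?orbT //; lia.
  have hf := anchor_start lfP an.
  by move=> bf; rewrite (IH a b f) //; lia.
have ncut o a b : start a < start o -> start b < start o -> start o <= n ->
    in_cut lf s L o a -> ~~ in_cut lf s L o b -> L a b.
  move=> ha hb ho ca cb.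
  have ab : a != b by apply/eqP => ab; rewrite ab (negPf cb) in ca.
  rewrite ordNC //; apply/negP => ba.
  by move: cb; rewrite (down o b a).
case: (ltngtP (start x) (start y)) => xy; case: (ltngtP (start y) (start z)) => yz;
  case: (ltngtP (start x) (start z)) => xz; try (by exfalso; lia).
- by rewrite (ord_early xy) (ord_early yz) (ord_early xz) -(ord_early xy); apply: down; lia.
- by rewrite (ord_early xy) (ord_late yz) => hx hz; apply: (ncut y) => //; lia.
- by rewrite (ord_early xy) (ord_late yz) => hx hz; apply: (ncut y) => //; lia.
- by rewrite (ord_early xy) (ord_late yz) => hx hz; apply: (ncut y) => //; lia.
- rewrite (ord_early xy) (ord_early xz) => + _.
  by rewrite (cut_same yz).
- by rewrite (ord_early yz) (ord_early xz) => hx hz; apply: (down z x y) => //; lia.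
- rewrite (ord_late xy) (ord_late xz) => + hyz; apply: contra => cz.
  by apply: (down x y z) => //; lia.
- by rewrite (ord_late xy) (ord_early yz) (cut_same xz) => /negPf ->.
- rewrite (ord_late xy) (ord_late xz) => + hyz; apply: contra => cz.
  by apply: (down x y z) => //; lia.
- rewrite (ord_late xy) (ord_late xz) => + hyz; apply: contra => cz.
  by apply: (down x y z) => //; lia.
- by rewrite (ord_early yz) (ord_early xz) => hx hz; apply: (down z x y) => //; lia.
- by rewrite (ord_late yz) (ord_late xz) (cut_same xy).
- rewrite (ord_same xy) (ord_same yz) (ord_same xz) => lxy lyz.
  apply: (lf_trans lfP lxy lyz).
  have [exz|[e [f [ex ez ef]]]] := start_eq lfP xz.
    by rewrite exz in lxy; have := lf_asym lfP lxy; rewrite lyz.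
  have := rank_edge lfP e; have := rank_edge lfP f.
  by rewrite /overlap ex ez /= ef; lia.
Qed.

Lemma ord_asym x y : L x y -> ~~ L y x.
Proof.
by move=> xy; apply/negP => /(ord_trans xy); rewrite ordxx.
Qed.

Lemma ord_neq x y : L x y -> x != y.
Proof. by move=> xy; apply/eqP => e; move: xy; rewrite e ordxx. Qed.

(** The later of the two objects has nothing between itself and its anchor, so
    the earlier one is the anchor or lies on the same side of both. *)
Lemma lf_ord x y : lf x y -> L x y.
Proof.
have [n] := ubnP (maxn (start x) (start y)).
elim: n x y => // n IH x y hn lxy.
have oxy := lf_overlap lfP lxy.
have nle o w : L w o -> ~~ ((o == w) || L o w).
  by move=> fo; rewrite negb_or ord_asym // eq_sym ord_neq.
case: (ltngtP (start x) (start y)) => h; last by rewrite ord_same.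
- rewrite ord_early //; case: y h hn lxy oxy => [v|e] h hn lxy oxy.
    have [f ex] := left_edge lfP lxy; rewrite {x}ex in h hn lxy oxy *.
    rewrite /in_cut /=; case re: (last_in lf v) => [e|].
      have he := last_in_hd re; rewrite -he in lxy.
      rewrite (IH (inr f) (inr e)) ?orbT //; last exact: lf_hd.
      by have := edge_start lfP e; rewrite he; slia.
    case: (s v).
      have [g [-> hg]] := left_nbrP lfP lxy; have := lf_edge_vertex (lf_overlap lfP hg).
      move=> gv /(_ _ lxy) [->|fg] /=; first by rewrite eqxx.
      by rewrite (IH (inr f) (inr g)) ?orbT; slia.
    case ng: (left_nbr (converse lf) v) => [g|//]; have hg := left_nbr_lf ng.
    apply: IH; last first.
      apply: (lf_trans lfP lxy hg).
      apply: cross_overlap oxy _; rewrite overlapC; exact: (lf_overlap lfP hg).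
    by have := lf_edge_vertex (lf_overlap (leftness_flip lfP) hg); slia.
  rewrite /in_cut /=; set a := inl (tl e).
  have xa : x != a by apply/eqP => xa; move: oxy; rewrite xa; slia.
  have oxa : overlap x a by move: oxy h; slia.
  have /orP[hxa|hax] := lf_total lfP xa oxa.
    rewrite (IH x a) ?orbT; slia.
  by have := lf_asym lfP lxy; rewrite (tl_lf lfP hax).
- rewrite ord_late //; case: x h hn lxy oxy => [v|e] h hn lxy oxy.
    have [f ey] := left_edge (leftness_flip lfP) lxy; rewrite {y}ey in h hn lxy oxy *.
    rewrite /in_cut /=; case re: (last_in lf v) => [e|].
      have he := last_in_hd re; rewrite -he in lxy.
      apply/nle/IH; last exact: hd_lf.
      by have := edge_start lfP e; rewrite he; slia.
    case: (s v).
      case ng: (left_nbr lf v) => [g|//]; have hg := left_nbr_lf ng.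
      apply/nle/IH; last first.
        apply: (lf_trans lfP hg lxy).
        by apply: cross_overlap (lf_overlap lfP hg) _; rewrite overlapC.
      by have := lf_edge_vertex (lf_overlap lfP hg); slia.
    have [g [-> hg]] := left_nbrP (leftness_flip lfP) lxy.
    have gv := lf_edge_vertex (lf_overlap (leftness_flip lfP) hg).
    move=> /(_ _ lxy) [->|fg] /=; first by rewrite ordxx.
    by apply/ord_asym/IH; [slia|].
  rewrite /in_cut /=; set a := inl (tl e).
  have ya : y != a by apply/eqP => xa; move: oxy; rewrite xa; slia.
  have oya : overlap y a by move: oxy h; slia.
  have /orP[hya|hay] := lf_total lfP ya oya.
    by have := lf_asym lfP lxy; rewrite (lf_tl lfP hya).
  by apply/nle/IH; [slia|].
Qed.

(** Once the head of [e] has been swept, insertions happen next to the head, to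
    later objects or to edges still alive. No such edge lies between [e] and its
    head in the order: an edge alive at the time of the head is on the same side
    of [e] and of the head. *)
Lemma ord_past e o : start (inl (hd e)) < start o ->
  L (inr e) o -> L (inl (hd e)) o.
Proof.
set b : O := inl (hd e).
have [n] := ubnP (start o); elim: n o => // n IH o hn bo eo.
have live (f : O) : start f < start o -> start b < stop f -> L (inr e) f -> L b f.
  move=> fo bf ef; have bf' : b != f by apply/eqP => h; move: bf; rewrite -h ltnn.
  case: (ltngtP (start b) (start f)) => h.
  - by apply: IH => //; slia.
  - have obf : overlap b f by rewrite /overlap (ltnW h) andbT /=; slia.
    have /orP[/lf_ord//|/(lf_hd lfP)/lf_ord] := lf_total lfP bf' obf.
    by move=> fe; have := ord_asym ef; rewrite fe.
  - case: f ef bf bf' h fo => [v|f] _ bf bf' h; last by slia.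
    by slia.
have sv : start (inr e) < start b := edge_start lfP e.
have seo : start (inr e) < start o by lia.
move: eo; rewrite (ord_early seo) (ord_early bo) /in_cut.
case: o hn bo live seo => [v|g] hn bo live seo /=; last first.
  have [->|bc] := eqVneq b (inl (tl g)); first by rewrite ?eqxx.
  rewrite /=; apply: IH; first by slia.
  have : r (hd e) != r (tl g).
    by apply: contra_neq bc => /(rank_inj lfP) h; rewrite /b h.
  by move: bo; slia.
case rv: (last_in lf v) => [f|].
  have hf := last_in_hd rv.
  have [ef|_] := eqVneq (inr e : O) (inr f).
    by move: ef bo => [ef]; rewrite /b ef hf; slia.
  have := edge_start lfP f; rewrite hf => ?.
  have hrf : r (hd f) = r v by rewrite hf.
  by move=> ef; apply/orP; right; apply: live ef => //; slia.
case: (s v).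
  case nf: (left_nbr lf v) => [f|] //=.
  have := lf_edge_vertex (lf_overlap lfP (left_nbr_lf nf)).
  have [ef|_] := eqVneq (inr e : O) (inr f).
    by case: ef => ef hf; exfalso; move: hf; rewrite -ef; slia.
  by move=> hf /= ef; apply: live ef; slia.
case nf: (left_nbr (converse lf) v) => [f|] //=.
have := lf_edge_vertex (lf_overlap (leftness_flip lfP) (left_nbr_lf nf)).
by move=> hf ef; apply: live ef; slia.
Qed.

End Linear.

(** * Two mirror-image orders and their intersection *)

Definition tail_time (oe : option E) :=
  if oe is Some e then (r (tl e)).+1 else 0.

(** A source is hung onto the neighbouring edge with the earlier tail, an absent
    neighbour counting as the earliest. Its foot then lies no later than the tail
    of the other neighbour, which is what keeps the covers bypassed by the source
    at a single tail. The condition is symmetric, as the two orders have to be. *)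
Record sweep (lf : rel O) (sl sr : pred V) : Prop := Sweep {
  sw_left : leftness lf;
  sw_side : forall v, sr v = ~~ sl v;
  sw_sl : forall v, sl v -> tail_time (left_nbr lf v) <= tail_time (left_nbr (converse lf) v);
  sw_sr : forall v, sr v -> tail_time (left_nbr (converse lf) v) <= tail_time (left_nbr lf v) }.

Lemma sweep_flip lf sl sr : sweep lf sl sr -> sweep (converse lf) sr sl.
Proof.
case=> lfP side hl hr; split=> //; first exact: leftness_flip.
by move=> v; rewrite side negbK.
Qed.

(** [below] and [leftof] are conjugate partial orders: distinct objects are
    comparable in exactly one of them. *)
Definition below lf (sl sr : pred V) x y := ins_order lf sl x y && ins_order (converse lf) sr x y.
Definition leftof lf (sl sr : pred V) x y := ins_order lf sl x y && ins_order (converse lf) sr y x.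

Lemma below_flip lf sl sr x y : below (converse lf) sr sl x y = below lf sl sr x y.
Proof. exact: andbC. Qed.

Lemma leftof_flip lf sl sr x y : leftof (converse lf) sr sl x y = leftof lf sl sr y x.
Proof. exact: andbC. Qed.

Definition foot lf (sl : pred V) v : option V :=
  if last_in lf v is Some _ then None
  else omap tl (if sl v then left_nbr lf v else left_nbr (converse lf) v).

Section TwoOrders.
Variables (lf : rel O) (sl sr : pred V).
Hypothesis sw : sweep lf sl sr.
Let lfP := sw_left sw.
Let rtP := leftness_flip lfP.
Local Notation L := (ins_order lf sl).
Local Notation R := (ins_order (converse lf) sr).
Local Notation Q := (below lf sl sr).
Local Notation lam := (leftof lf sl sr).
Opaque ins_order.

(* [ords] closes a goal whose hypotheses force a cycle in one of the two orders,
   [ordsQ] proves a comparison that follows by transitivity. *)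
Ltac ords_step :=
  match goal with
  | H : is_true (ins_order lf sl ?a ?a) |- _ => by rewrite (ordxx sl lfP) in H
  | H : is_true (ins_order (converse lf) sr ?a ?a) |- _ => by rewrite (ordxx sr rtP) in H
  | H1 : is_true (ins_order lf sl ?a ?b), H2 : is_true (ins_order lf sl ?b ?c) |- _ =>
      lazymatch goal with _ : is_true (ins_order lf sl a c) |- _ => fail | _ => idtac end;
      have := ord_trans lfP H1 H2; let h := fresh "h" in intro h
  | H1 : is_true (ins_order (converse lf) sr ?a ?b),
    H2 : is_true (ins_order (converse lf) sr ?b ?c) |- _ =>
      lazymatch goal with
      | _ : is_true (ins_order (converse lf) sr a c) |- _ => fail | _ => idtac end;
      have := ord_trans rtP H1 H2; let h := fresh "h" in intro h
  end.
Ltac ords_split :=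
  match goal with
  | H : is_true (below lf sl sr _ _) |- _ =>
      let h1 := fresh "h" in let h2 := fresh "h" in case/andP: (H) => h1 h2; clear H
  | H : is_true (leftof lf sl sr _ _) |- _ =>
      let h1 := fresh "h" in let h2 := fresh "h" in case/andP: (H) => h1 h2; clear H
  end.
Ltac ords_clean := repeat match goal with x := _ : sum _ _ |- _ => subst x end.
Ltac ords := exfalso; ords_clean; repeat ords_split; repeat ords_step.
Ltac ordsQ := ords_clean; repeat ords_split; apply/andP; split;
  repeat (match goal with H : ?P |- ?P => exact H end || ords_step).

Lemma below_trans y x z : Q x y -> Q y z -> Q x z.
Proof. by move=> xy yz; ordsQ. Qed.

Lemma below_neq x y : Q x y -> x != y.
Proof. by case/andP => /(ord_neq lfP). Qed.

Lemma leftof_neq x y : lam x y -> x != y.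
Proof. by case/andP => /(ord_neq lfP). Qed.

Lemma order_cases x y : x != y -> [\/ Q x y, Q y x, lam x y | lam y x].
Proof.
move=> xy; rewrite /below /leftof.
have := ordNC sl lfP xy; have := ordNC sr rtP xy.
case: (L x y); case: (L y x) => // h; case: (R x y) h; case: (R y x) => // _ _.
- exact: Or41.
- exact: Or43.
- exact: Or44.
- exact: Or42.
Qed.

Lemma lf_leftof x y : lf x y -> lam x y.
Proof. by move=> xy; rewrite /leftof !lf_ord. Qed.

(** Overlapping objects lie side by side, so an edge has nothing above it as long
    as the sweep meets it. *)
Lemma overlap_not_below x y : overlap x y -> Q x y -> False.
Proof.
move=> oxy qxy; have /orP[] := lf_total lfP (below_neq qxy) oxy.
  by move/lf_leftof => h; ords.
by move/lf_leftof => h; ords.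
Qed.

Lemma last_in_flip v f : last_in lf v = Some f ->
  exists g, last_in (converse lf) v = Some g /\ (g = f \/ lf (inr g) (inr f)).
Proof.
move=> rf; have [g [rg hg gmax]] := last_inP rtP (last_in_hd rf); exists g; split=> //.
by have [->|] := gmax f (last_in_hd rf); [left|right].
Qed.

Lemma last_in_none_flip v : last_in lf v = None -> last_in (converse lf) v = None.
Proof.
move=> rn; case rg: (last_in (converse lf) v) => [g|//].
by have := last_in_none lfP rn (last_in_hd rg).
Qed.

(** Each object is maximal for [below] when it is inserted. Otherwise an older
    object would lie after the anchor in both orders. If the two anchors coincide,
    it lies above an edge still alive or above the tail of an edge that is just
    starting. If they are the rightmost and the leftmost edge entering a vertex,
    it lies above neither, so it is to the right of the former and to the left
    of the latter. *)
Lemma below_start x y : Q x y -> start x < start y.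
Proof.
rewrite ltnNge => qxy; apply/negP => yx.
have [n] := ubnP (start x); elim: n x y yx qxy => // n IH x y yx qxy hn.
have live (f : O) : start f < start x -> start y <= stop f -> Q f y -> False.
  move=> fx yf qfy; case: (leqP (start f) (stop y)) => h.
    by apply: (overlap_not_below _ qfy); rewrite /overlap h yf.
  apply: (IH f y) => //; first by have := start_stop lfP y; lia.
  by lia.
move: yx; rewrite leq_eqVlt => /predU1P[/esym/(start_eq lfP)[xy|]|yx].
- by have := below_neq qxy; rewrite xy eqxx.
- move=> [e [f [ex ey ef]]]; apply: overlap_not_below qxy.
  have := rank_edge lfP e; have := rank_edge lfP f.
  by rewrite /overlap ex ey /= ef; lia.
have ncutL a : y != a -> ~~ ((y == a) || L y a) -> L a y.
  by move=> ya; rewrite (negPf ya) /= => h; rewrite (ordNC sl lfP) // eq_sym.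
have ncutR a : y != a -> ~~ ((y == a) || R y a) -> R a y.
  by move=> ya; rewrite (negPf ya) /= => h; rewrite (ordNC sr rtP) // eq_sym.
have neqL a : ~~ ((y == a) || L y a) -> y != a by rewrite negb_or => /andP[].
have neqR a : ~~ ((y == a) || R y a) -> y != a by rewrite negb_or => /andP[].
case/andP: (qxy); rewrite !ord_late // /in_cut.
case: x yx hn live qxy => [v|e] yx hn live qxy /=; last first.
  move=> hL hR; have ya := neqL _ hL.
  apply: (IH (inl (tl e)) y); [slia| |slia].
  by rewrite /below ncutL // ncutR.
case rf: (last_in lf v) => [f|].
  have [g [-> gf]] := last_in_flip rf; have hf := last_in_hd rf.
  move=> hL hR; have yf := neqL _ hL; have yg := neqR _ hR.
  have Lfy := ncutL _ yf hL; have Rgy := ncutR _ yg hR.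
  have Ryf : R y (inr f).
    rewrite (ordNC sr rtP) //; apply/negP => Rfy.
    apply: (live (inr f)); last by rewrite /below Lfy Rfy.
      by have := edge_start lfP f; rewrite hf.
    by move: yx; rewrite /= hf => yx; rewrite -ltnS (leq_trans yx) ?leqSpred.
  case: gf => [egf|/lf_leftof gf]; last by ords.
  by rewrite egf in Rgy; ords.
rewrite (last_in_none_flip rf) (sw_side sw); case: (sl v) => /=.
  case nf: (left_nbr lf v) => [f|] //= hL hR; have yf := neqL _ hL.
  have := lf_edge_vertex (lf_overlap lfP (left_nbr_lf nf)) => fv.
  apply: (live (inr f)); [slia|slia|].
  by rewrite /below ncutL //= (ordNC sr rtP) // eq_sym.
case nf: (left_nbr (converse lf) v) => [f|] //=.
move=> /= hR hL; have yf := neqR _ hL.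
have := lf_edge_vertex (lf_overlap rtP (left_nbr_lf nf)) => fv.
apply: (live (inr f)); [slia|slia|].
by rewrite /below ncutR // andbT (ordNC sl lfP) // eq_sym.
Qed.

Lemma below_tl e : Q (inl (tl e)) (inr e).
Proof.
have h : start (inl (tl e)) < start (inr e) by slia.
by rewrite /below !ord_early // /in_cut /= eqxx.
Qed.

Lemma leq_last_in o v f : last_in lf v = Some f -> Q o (inl v) -> (o == inr f) || L o (inr f).
Proof.
by move=> rf /[dup] /below_start h /andP[+ _]; rewrite ord_early // /in_cut /= rf.
Qed.

Lemma below_edge o e : Q o (inr e) -> o = inl (tl e) \/ Q o (inl (tl e)).
Proof.
move=> /[dup] /below_start h /andP[]; rewrite !ord_early // /in_cut /= .
by have [->|_] /= := eqVneq o (inl (tl e)); [left|move=> h1 h2; right; rewrite /below h1].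
Qed.

Lemma edge_below e o : Q (inr e) o -> o = inl (hd e) \/ Q (inl (hd e)) o.
Proof.
move=> /[dup] q /[dup] /below_start h /andP[qL qR].
have hs : start (inl (hd e)) <= start o.
  rewrite leqNgt; apply/negP => ho; apply: overlap_not_below q.
  by have := start_stop lfP o; slia.
move: hs; rewrite leq_eqVlt => /predU1P[/(start_eq lfP)[->|[f [g []]]//]|hs].
  by left.
by right; rewrite /below (ord_past lfP hs qL) (ord_past rtP hs qR).
Qed.

Lemma below_hd e : Q (inr e) (inl (hd e)).
Proof.
have h := edge_start lfP e; have [f [rf hf fmax]] := last_inP lfP (erefl (hd e)).
have [g [rg gf]] := last_in_flip rf.
rewrite /below !ord_early // /in_cut /= rf rg.
have [->|/lf_leftof/andP[-> _]] := fmax e erefl.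
  rewrite eqxx /=; case: gf => [->|/lf_leftof/andP[_ ->]]; first by rewrite eqxx.
  by rewrite orbT.
rewrite orbT /=.
have [->|] := last_in_max rtP rg (erefl (hd e)); first by rewrite eqxx.
by move/(@lf_ord _ sr rtP) => ->; rewrite orbT.
Qed.

(** A source is inserted like the head of an edge that starts at its foot. *)
Lemma below_source o v : last_in lf v = None -> Q o (inl v) ->
  exists2 a, foot lf sl v = Some a & o = inl a \/ Q o (inl a).
Proof.
move=> rn /[dup] q /[dup] /below_start h /andP[].
rewrite !ord_early // /in_cut /= rn (last_in_none_flip rn) (sw_side sw) /foot rn.
case: (sl v) => /=.
  have -> : left_nbr (converse (converse lf)) v = left_nbr lf v by [].
  case nf: (left_nbr lf v) => [f|] //= oL oR.
  exists (tl f) => //; apply: below_edge.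
  by rewrite /below oR andbT; case/predU1P: oL oR => [->|-> //]; rewrite ordxx.
case nf: (left_nbr (converse lf) v) => [f|] //= oL oR.
exists (tl f) => //; apply: below_edge.
by rewrite /below oL; case/predU1P: oR oL => [->|-> //]; rewrite ordxx.
Qed.

Lemma foot_tail v a : foot lf sl v = Some a -> exists2 f, tl f = a & r a < r v.
Proof.
rewrite /foot; case rv: (last_in lf v) => [//|]; case: (sl v).
  case nf: (left_nbr lf v) => [f|] //= [<-]; exists f => //.
  by case/andP: (lf_edge_vertex (lf_overlap lfP (left_nbr_lf nf))).
case nf: (left_nbr (converse lf) v) => [f|] //= [<-]; exists f => //.
by case/andP: (lf_edge_vertex (lf_overlap rtP (left_nbr_lf nf))).
Qed.

(** A chain leading from the right of the tail of [e] to the left of its head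
    would have to cross [e], as its members are on the sides of [e] or comparable
    to its ends. *)
Lemma edge_separates e x y : Q x y ->
  lam (inl (tl e)) x -> lam y (inl (hd e)) -> False.
Proof.
move=> xy ax yb; have ae := below_tl e; have eb := below_hd e.
have xe : x != inr e by apply/eqP => h; subst x; ords.
have ye : y != inr e by apply/eqP => h; subst y; ords.
have [/below_edge[h|h]|/edge_below[h|h]|h|h] := order_cases xe.
- by subst x; ords.
- by ords.
- by subst x; ords.
- by ords.
- by ords.
have [/below_edge[h'|h']|/edge_below[h'|h']|h'|h'] := order_cases ye.
- by subst y; ords.
- by ords.
- by subst y; ords.
- by ords.
- by ords.
- by ords.
Qed.

Lemma between_overlap e v : Q (inl (tl e)) (inl v) -> Q (inl v) (inl (hd e)) ->
  overlap (inr e) (inl v).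
Proof. by move=> /below_start h1 /below_start h2; apply: edge_vertex_overlap; slia. Qed.

Definition is_sink v := [forall e, tl e != v].
Definition is_source v := [forall e, hd e != v].
(** For a sink, the vertex at which the sweep closes the region above it. *)
Definition is_roof (y t : O) := Q y t && [forall o, Q y o ==> (start t <= start o)].

Lemma sink_roof_exists y o : Q y o -> exists t : O, is_roof y t.
Proof.
move=> yo; case: (@arg_minnP O o (Q y) start yo) => t yt tmin.
by exists t; rewrite /is_roof yt; apply/forallP => w; apply/implyP/tmin.
Qed.

Lemma last_in_bounds v f g : last_in lf v = Some f -> last_in (converse lf) v = Some g ->
  [/\ Q (inr f) (inl v), Q (inr g) (inl v) &
   forall o, Q o (inl v) -> ((o == inr f) || L o (inr f)) /\ ((o == inr g) || R o (inr g))].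
Proof.
move=> rf rg; have hf := last_in_hd rf; have hg := last_in_hd rg; split.
- by have := below_hd f; rewrite hf.
- by have := below_hd g; rewrite hg.
move=> o ov; have ho := below_start ov; split; first exact: leq_last_in ov.
by case/andP: ov => _; rewrite ord_early // /in_cut /= rg.
Qed.

(** The roof is a vertex with an incoming edge on either side of the sink. An object
    above the sink is past one of these two edges in each order, hence past the
    roof. *)
Lemma sink_roof_below v (t o : O) : is_sink v -> is_roof (inl v) t -> Q (inl v) o ->
  o = t \/ Q t o.
Proof.
move: v => y.
move=> /forallP sy /andP[yt /forallP tmin] yo.
have {}tmin w : Q (inl y) w -> start t <= start w by move/(implyP (tmin w)).
have nosink f : tl f = y -> False by move=> h; have := sy f; rewrite h eqxx.
case: t yt tmin => [v|f] yt tmin; last first.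
  case/below_edge: yt => [[/esym/nosink//]|/tmin]; slia.
case rf: (last_in lf v) => [f|]; last first.
  have [a /foot_tail[f fa av] [[ya]|/tmin]] := below_source rf yt; last by slia.
  by case: (nosink f); rewrite fa ya.
have [g [rg _]] := last_in_flip rf; have [fv gv /(_ _ yt)[yf yg]] := last_in_bounds rf rg.
rewrite /= in yf yg.
have Rfy : R (inr f) (inl y).
  rewrite (ordNC sr rtP) //; apply/negP => Ryf.
  have /tmin : Q (inl y) (inr f) by rewrite /below yf.
  by rewrite leqNgt (below_start fv).
have Lgy : L (inr g) (inl y).
  rewrite (ordNC sl lfP) //; apply/negP => Lyg.
  have /tmin : Q (inl y) (inr g) by rewrite /below Lyg.
  by rewrite leqNgt (below_start gv).
have := tmin _ yo; rewrite leq_eqVlt => /predU1P[/esym/(start_eq lfP)[->|[? [? [_]]] //]|h].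
  by left.
right; case/andP: yo => Lyo Ryo; apply/andP; split.
  have := @ord_past lf sl lfP g o; rewrite (last_in_hd rg); apply=> //.
  exact: ord_trans Lgy Lyo.
have := @ord_past (converse lf) sr rtP f o; rewrite (last_in_hd rf); apply=> //.
exact: ord_trans Rfy Ryo.
Qed.

(** A comparison between a vertex that is not a sink and a vertex that is not a
    source passes through an edge leaving the former or entering the latter. *)
Lemma below_refine f v e : Q (inl (tl f)) (inl v) -> hd e = v ->
  exists2 w, Q (inl (tl f)) w & Q w (inl v).
Proof.
set x : O := inl (tl f) => xv he.
have [p [rp hp _]] := last_inP lfP he; have [q [rq _]] := last_in_flip rp.
have [pv qv /(_ _ xv)[/= Lxp Rxq]] := last_in_bounds rp rq.
have xf : Q x (inr f) := below_tl f.
have [Rxp|nRxp] := boolP (R x (inr p)); first by exists (inr p); rewrite // /below Lxp.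
have [Lxq|nLxq] := boolP (L x (inr q)); first by exists (inr q); rewrite // /below Lxq.
have Rpx : R (inr p) x by rewrite (ordNC sr rtP).
have Lqx : L (inr q) x by rewrite (ordNC sl lfP).
have [fv|fv] := eqVneq (hd f) v; first by exists (inr f); rewrite // -fv below_hd.
exists (inr f) => //.
have hne (h : E) : hd h = v -> inr f != inr h :> O.
  by move=> hh; apply: contra_neq fv => -[->].
have Lfp : L (inr f) (inr p).
  rewrite (ordNC sl lfP) ?hne ?(last_in_hd rp) //; apply/negP => Lpf.
  have pf : Q (inr p) (inr f).
    by rewrite /below Lpf (ord_trans rtP Rpx) //; case/andP: xf.
  by case/below_edge: pf => // /andP[+ _]; move: (ord_asym lfP Lxp) => /negP.
have Rfq : R (inr f) (inr q).
  rewrite (ordNC sr rtP) ?hne ?(last_in_hd rq) //; apply/negP => Rqf.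
  have qf : Q (inr q) (inr f).
    by rewrite /below Rqf (ord_trans lfP Lqx) //; case/andP: xf.
  by case/below_edge: qf => // /andP[_ +]; move: (ord_asym rtP Rxq) => /negP.
by ordsQ.
Qed.

Section Bypassed.
Variable (lt : rel V).
Hypothesis lt_trans : transitive lt.
Hypothesis lt_edge : forall e, lt (tl e) (hd e).
Hypothesis lt_cover : forall e c, lt (tl e) c -> ~~ lt c (hd e).
Hypothesis edge_inj : forall e f, tl e = tl f -> hd e = hd f -> e = f.

(** The objects strictly between the ends of [e] and to its right have a left
    boundary, running along [e]. Follow it: every boundary object other than a
    source is reached from the tail of [e] by a path of edges, and a source on
    the boundary has [e] as its left neighbour, so its foot is the tail of [e]: a
    foot on the right of [e] would be no later than this tail, yet above it. The
    object of the boundary farthest from the tail is an edge entering the head of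
    [e], which with the path contradicts that [e] is a cover, or a sink with the
    head as its roof. *)
Lemma bypassed_right e (z : V) :
  Q (inl (tl e)) (inl z) -> Q (inl z) (inl (hd e)) -> lam (inr e) (inl z) ->
  (exists v, foot lf sl v = Some (tl e)) \/
  (exists2 v, is_sink v & is_roof (inl v) (inl (hd e))).
Proof.
set a : O := inl (tl e); set b : O := inl (hd e) => az zb ez.
have [/existsP[v /eqP hv]|/existsPn nfoot] :=
  boolP [exists v, foot lf sl v == Some (tl e)]; first by left; exists v.
right.
have ae : Q a (inr e) := below_tl e.
have eb : Q (inr e) b := below_hd e.
(* The objects between the ends of [e], on the right of [e]. *)
pose N o := [&& Q a o, Q o b & lam (inr e) o].
have Ncomp x w : N x -> Q a w -> Q w b -> Q w x \/ Q x w -> N w.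
  move=> /and3P[ax xb ex] aw wb wx; rewrite /N aw wb /=.
  have we : w != inr e by apply/eqP => h; subst w; case: wx => h; ords.
  have [/below_edge[h|h]|/edge_below[h|h]|h|//] := order_cases we.
  - by subst w; ords.
  - by ords.
  - by subst w; ords.
  - by ords.
  by case: wx => h'; ords.
(* Their left boundary. *)
pose B o := N o && [forall w, N w ==> ~~ lam w o].
have BP o w : B o -> N w -> lam w o -> False.
  by case/andP=> _ /forallP/(_ w)/implyP h /h /negP.
have mkB o : N o -> (forall w, N w -> lam w o -> False) -> B o.
  move=> No h; rewrite /B No; apply/forallP => w; apply/implyP => Nw.
  by apply/negP; apply: h.
have reach o : B o -> match o return Prop with
    | inl x => lt (tl e) x | inr f => tl f = tl e \/ lt (tl e) (tl f) end.
  have [n] := ubnP (start o); elim: n o => // n IH o hn Bo.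
  have /and3P[ao ob eo] : N o by case/andP: Bo.
  case: o hn Bo ao ob eo => [x|f] hn Bo ao ob eo; last first.
    have cf := below_tl f; set c : O := inl (tl f) in cf *.
    case/below_edge: (ao) => [[]//|ac]; first by left.
    have cb : Q c b := below_trans cf ob.
    have Nc : N c by apply: (Ncomp (inr f)) => //; [case/andP: Bo|left].
    right; apply: (IH c); first exact: leq_trans (below_start cf) hn.
    apply: mkB => // w Nw wc.
    have wf : w != inr f by apply/eqP => h; subst w; ords.
    have [/below_edge[h|h]|h|h|h] := order_cases wf.
    - by subst w; have := leftof_neq wc; rewrite eqxx.
    - by ords.
    - by ords.
    - exact: BP Bo Nw h.
    by ords.
  have lex : lf (inr e) (inl x).
    have ov : overlap (inr e) (inl x).
      exact: between_overlap ao ob.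
    have /orP[//|/lf_leftof h] := lf_total lfP (leftof_neq eo) ov.
    by ords.
  case rf: (last_in lf x) => [f|].
    (* The leftmost edge entering [x] is again on the boundary. *)
    have [g [rg _]] := last_in_flip rf; have [fx gx gmax] := last_in_bounds rf rg.
    have eg : lam (inr e) (inr g).
      by apply/lf_leftof/(lf_hd lfP); rewrite (last_in_hd rg).
    have ag : Q a (inr g).
      have [_ /= Rag] := gmax _ ao; by ordsQ.
    have gb : Q (inr g) b := below_trans gx ob.
    have Ng : N (inr g) by rewrite /N ag gb eg.
    have Bg : B (inr g).
      apply: mkB => // w Nw wg.
      have wx : w != inl x by apply/eqP => h; subst w; ords.
      have [/gmax[_ /predU1P[h|h]]|h|h|h] := order_cases wx.
      - by subst w; have := leftof_neq wg; rewrite eqxx.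
      - by ords.
      - by ords.
      - exact: BP Bo Nw h.
      by ords.
    have := IH _ (leq_trans (below_start gx) hn) Bg.
    have := lt_edge g; rewrite (last_in_hd rg) => hgx [<-//|/lt_trans]; exact.
  (* A source: its left neighbour is [e], and hanging it onto the right
     neighbour would mean a foot no later than the tail of [e]. *)
  exfalso.
  have [a' ha' [[eaa']|aa']] := below_source rf ao.
    by have := nfoot x; rewrite ha' -eaa' eqxx.
  have [l [nl lx /(_ _ lex)[el|el]]] := left_nbrP lfP lex; last first.
    move: el lx => /lf_leftof el /lf_leftof lx.
    have Nl : N (inr l).
      rewrite /N el andbT; apply/andP; split; by ordsQ.
    exact: BP Bo Nl lx.
  move: ha' (nfoot x); rewrite /foot rf nl -el.
  have := sw_sr sw (v := x); rewrite (sw_side sw); case: (sl x) => /= [_ _|].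
    by rewrite eqxx.
  move=> /(_ isT); rewrite nl -el; case: (left_nbr (converse lf) x) => [g|] //= hg [ega'] _.
  rewrite ltnS in hg; have := below_start aa'.
  by rewrite -ega' /a /= ltn_double ltnNge hg.
have Nz : N (inl z) by rewrite /N az zb ez.
(* The right-first order ends with the leftmost objects, so its last element in
   [N] is the upper end of the boundary. *)
have [|||x Nx xmax] := @exists_maximal _ N R (inl z).
- by move=> o; rewrite ordxx.
- by move=> o1 o2 o3 _ _ _; apply: ord_trans.
- by [].
have Qmax w : N w -> Q x w -> False.
  by move=> Nw /andP[_]; apply/negP; apply: xmax.
have Bx : B x by apply: mkB => // w Nw /andP[_]; apply/negP; apply: xmax.
have /and3P[ax xb ex] := Nx.
case: x Nx xmax Qmax Bx ax xb ex => [y|f] Nx xmax Qmax Bx ax xb ex; last first.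
  exfalso; have fd := below_hd f; case/edge_below: (xb) => [[hef]|db].
    case: (reach _ Bx) => h; first by have := leftof_neq ex; rewrite (edge_inj h) ?eqxx.
    by have := lt_cover h; rewrite hef lt_edge.
  by apply: (Qmax _ _ fd); apply: (Ncomp (inr f)) => //; [apply: below_trans fd|right].
have [sy|/forallPn[f]] := boolP (is_sink y); last first.
  rewrite negbK => /eqP ef; exfalso; move: xb; rewrite -ef => xb.
  have [w fw wb] := below_refine xb erefl; rewrite ef in fw.
  apply: (Qmax _ _ fw); apply: (Ncomp (inl y)) => //; [exact: below_trans fw|by right].
exists y => //; have [t yt] := sink_roof_exists xb.
have [->//|tb] := sink_roof_below sy yt xb; exfalso.
have /andP[yt' _] := yt.
apply: (Qmax _ _ yt'); apply: (Ncomp (inl y)) => //; [exact: below_trans yt'|by right].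
Qed.
End Bypassed.

Lemma ord_or_below x y : L x y -> Q x y \/ lam x y.
Proof.
move=> xy; rewrite /below /leftof xy /= (ordNC sr rtP) ?(ord_neq lfP xy) //.
by case: (R y x); [right|left].
Qed.

Lemma tl_below_hd e : Q (inl (tl e)) (inl (hd e)).
Proof. exact: below_trans (below_tl e) (below_hd e). Qed.

End TwoOrders.

(** * Nested covers *)

Section Nested.
Variables (lf : rel O) (sl sr : pred V).
Hypothesis sw : sweep lf sl sr.
Let lfP := sw_left sw.
Local Notation L := (ins_order lf sl).
Local Notation Q := (below lf sl sr).
Local Notation lam := (leftof lf sl sr).

Lemma edge_separates_flip e x y : Q x y ->
  lam x (inl (tl e)) -> lam (inl (hd e)) y -> False.
Proof.
rewrite -(below_flip lf sl sr) -!(leftof_flip lf sl sr).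
exact: (edge_separates (sweep_flip sw)).
Qed.

Definition bypassed e :=
  [exists v, Q (inl (tl e)) (inl v) && Q (inl v) (inl (hd e))].

Definition nests e f :=
  L (inl (tl e)) (inl (tl f)) && L (inl (hd f)) (inl (hd e)).

Lemma not_bypassed e v : ~~ bypassed e ->
  Q (inl (tl e)) (inl v) -> Q (inl v) (inl (hd e)) -> False.
Proof. by move=> /existsPn/(_ v) /negP h h1 h2; apply: h; rewrite h1. Qed.

Lemma nests_tl_below e f : ~~ bypassed e -> nests e f ->
  Q (inl (tl e)) (inl (tl f)) -> lam (inl (hd f)) (inl (hd e)).
Proof.
move=> ke /andP[_ /(ord_or_below sw)[h|//]] h'; exfalso; apply: not_bypassed ke h' _.
exact: (below_trans sw (tl_below_hd sw f) h).
Qed.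

Lemma nests_tl_leftof e f : nests e f ->
  lam (inl (tl e)) (inl (tl f)) -> Q (inl (hd f)) (inl (hd e)).
Proof.
move=> /andP[_ /(ord_or_below sw)[//|h]] h'; exfalso.
exact: (edge_separates sw (tl_below_hd sw f) h' h).
Qed.

(** Let [k] be the innermost edge. Any other one has its tail below that of [k] and
    its head to the right of that of [k], or its tail to the left of that of [k]
    and its head above that of [k]. The heads in the first case, the tails in the
    second, and the tail of [k] form an antichain: a comparison between two of
    them would force a chain to cross [k] or one of the two edges, or make one of
    the two edges bypassed. *)
Lemma nests_antichain es : pairwise nests es -> all (predC bypassed) es ->
  exists2 A : {set V}, #|A| = size es &
    forall u v, u \in A -> v \in A -> ~~ Q (inl u) (inl v).
Proof.
case/lastP: es => [|es k].
  by move=> _ _; exists finset.set0; [rewrite cards0|move=> u v; rewrite inE].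
rewrite pairwise_rcons all_rcons /= => /andP[nk nes] /andP[kk kes].
pose c e := if Q (inl (tl e)) (inl (tl k)) then hd e else tl e.
pose inc u v := lam (inl u) (inl v) || lam (inl v) (inl u).
have ck e : nests e k -> ~~ bypassed e -> inc (c e) (tl k).
  move=> ek ke; rewrite /c; have tk := tl_below_hd sw k.
  have /andP[/(ord_or_below sw) Le Lk] := ek; case: ifPn => [q|nq].
    have /(ord_or_below sw)[h|h] : L (inl (tl k)) (inl (hd e)).
    - by case/andP: tk => h _; exact: (ord_trans lfP h Lk).
    - by case: (not_bypassed ke q h).
    by rewrite /inc h orbT.
  by case: Le => [q|h]; [rewrite q in nq|rewrite /inc h].
have cc e f : nests e f -> nests e k -> nests f k -> ~~ bypassed e -> ~~ bypassed f ->
    inc (c e) (c f).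
  move=> ef ek fk ke kf; rewrite /c.
  have /andP[Lef Lfe] := ef; have /andP[Lek Lke] := ek; have /andP[Lfk Lkf] := fk.
  have te := tl_below_hd sw e; have tf := tl_below_hd sw f; have tk := tl_below_hd sw k.
  have Lee : L (inl (tl e)) (inl (hd k)) by case/andP: tk => h _; exact: (ord_trans lfP Lek h).
  have Lff : L (inl (tl k)) (inl (hd e)) by case/andP: tk => h _; exact: (ord_trans lfP h Lke).
  have tQ h : ~~ Q (inl (tl h)) (inl (tl k)) -> L (inl (tl h)) (inl (tl k)) ->
      lam (inl (tl h)) (inl (tl k)).
    by move=> /negPf hQ /(ord_or_below sw)[]; rewrite ?hQ.
  case: ifPn => [qe|/tQ/(_ Lek) qe]; case: ifPn => [qf|/tQ/(_ Lfk) qf].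
  - case: (ord_or_below sw Lfe) => h; last by rewrite /inc h orbT.
    case: (ord_or_below sw Lef) => h'; first by case: (not_bypassed ke h' (below_trans sw tf h)).
    case: (ord_or_below sw Lff) => h''; first by case: (not_bypassed ke qe).
    by case: (edge_separates sw qf h' h'').
  - have ek' := nests_tl_below ke ek qe.
    have /(ord_or_below sw)[h|h] : L (inl (tl f)) (inl (hd e)).
    - by exact: (ord_trans lfP Lfk Lff).
    - by case: (edge_separates_flip h qf ek').
    by rewrite /inc h orbT.
  - have fk' := nests_tl_below kf fk qf.
    have /(ord_or_below sw)[h|h] : L (inl (tl e)) (inl (hd f)).
    - by exact: (ord_trans lfP Lee Lkf).
    - by case: (edge_separates_flip h qe fk').
    by rewrite /inc h.
  - case: (ord_or_below sw Lef) => h; last by rewrite /inc h.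
    case: (ord_or_below sw Lee) => h'.
      by case: (not_bypassed ke h'); apply: nests_tl_leftof.
    by case: (edge_separates sw (nests_tl_leftof fk qf) h' (nests_tl_below ke ef h)).
have incP : pairwise inc (rcons (map c es) (tl k)).
  rewrite pairwise_rcons; apply/andP; split.
    apply/allP => u /mapP[e ees ->]; apply: ck; first exact: (allP nk).
    exact: (allP kes).
  rewrite pairwise_map; move: nk nes kes; elim: es => //= e es IH.
  move=> /andP[ek nk] /andP[eall nes] /andP[ke kes]; rewrite IH // andbT.
  apply/allP => f fes; apply: cc => //; [exact: (allP eall)|exact: (allP nk)|].
  exact: (allP kes).
have irr : irreflexive inc by move=> u; rewrite /inc /leftof (ordxx sl lfP).
have un : uniq (rcons (map c es) (tl k)) by apply: pairwise_uniq incP.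
exists [set u in rcons (map c es) (tl k)]%SET.
  by rewrite cardsE (card_uniqP un) !size_rcons size_map.
have incQ u v : inc u v -> ~~ Q (inl u) (inl v).
  move=> /orP[] /andP[hL hR]; apply/negP => /andP[qL qR].
    by have := ord_asym (leftness_flip lfP) hR; rewrite qR.
  by have := ord_asym lfP hL; rewrite qL.
have symm : symmetric inc by move=> u v; rewrite /inc orbC.
move=> u v; rewrite !inE => us vs; have [->|uv] := eqVneq u v.
  by rewrite /below (ordxx sl lfP).
apply: incQ; move: un incP us vs uv; set l := rcons _ _.
elim: l => //= x l IH /andP[xl ul] /andP[/allP hx pl]; rewrite !inE.
move=> /predU1P[->|ul'] /predU1P[->|vl'] uv.
- by rewrite eqxx in uv.
- exact: hx.
- by rewrite symm; apply: hx.
exact: IH.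
Qed.

End Nested.

Lemma foot_flip lf sl sr v : sweep lf sl sr -> foot (converse lf) sr v = foot lf sl v.
Proof.
move=> sw; have lfP := sw_left sw; rewrite /foot (sw_side sw).
case rf: (last_in lf v) => [f|]; first by have [g [-> _]] := last_in_flip sw rf.
by rewrite (last_in_none_flip sw rf); case: (sl v).
Qed.

Section Count.
Variables (lf : rel O) (sl sr : pred V) (lt : rel V).
Hypothesis sw : sweep lf sl sr.
Hypothesis lt_trans : transitive lt.
Hypothesis lt_edge : forall e, lt (tl e) (hd e).
Hypothesis lt_cover : forall e c, lt (tl e) c -> ~~ lt c (hd e).
Hypothesis edge_inj : forall e f, tl e = tl f -> hd e = hd f -> e = f.
Local Notation Q := (below lf sl sr).

(** The vertex that bypasses [e] overlaps it, hence is on its right or, by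
    symmetry, on its left. *)
Lemma bypassed_charge e : bypassed lf sl sr e ->
  (exists v, foot lf sl v = Some (tl e)) \/
  (exists2 v, is_sink v & is_roof lf sl sr (inl v) (inl (hd e))).
Proof.
case/existsP=> v /andP[av vb]; have lfP := sw_left sw.
have ov : overlap (inr e) (inl v) := between_overlap sw av vb.
have /orP[h|h] := lf_total lfP (isT : (inr e : O) != inl v) ov.
  exact: (bypassed_right sw lt_trans lt_edge lt_cover edge_inj av vb (lf_leftof sw h)).
have sw' := sweep_flip sw.
have := @bypassed_right _ _ _ sw' lt lt_trans lt_edge lt_cover edge_inj e v.
rewrite !(below_flip lf sl sr) (leftof_flip lf sl sr) => /(_ av vb (lf_leftof sw h)).
case=> [[u hu]|[u su tu]]; [left; exists u|right; exists u => //].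
  by rewrite -(foot_flip u sw).
move: tu; rewrite /is_roof (below_flip lf sl sr) => /andP[-> /forallP tu] /=.
by apply/forallP => o; have := tu o; rewrite (below_flip lf sl sr).
Qed.

(** Nested edges have distinct tails and distinct heads, so each source and each
    sink accounts for at most one of them. The first vertex has no earlier vertex
    to be its foot, the last one no later vertex to be its roof. *)
Lemma nested_size (w : nat) es (v0 : V) :
  (forall A : {set V}, (forall u v, u \in A -> v \in A -> ~~ Q (inl u) (inl v)) ->
     #|A| <= w) ->
  pairwise (nests lf sl) es ->
  size es <= w + (#|[set v | is_source v]%SET|.-1 + #|[set v | is_sink v]%SET|.-1).
Proof.
move=> width nes; have lfP := sw_left sw.
pose k := bypassed lf sl sr; rewrite -(count_predC (predC k) es) -!size_filter.
apply: leq_add.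
  have [||A <- hA] := @nests_antichain lf sl sr sw (seq.filter (predC k) es).
  - by apply: pairwise_filter.
  - exact: filter_all.
  exact: width.
set ks := seq.filter _ es.
have kks : all k ks.
  by apply/allP => e; rewrite mem_filter /= negbK => /andP[].
have nks : pairwise (nests lf sl) ks by apply: pairwise_filter.
have ut : uniq (map tl ks).
  have : pairwise (fun u v => ins_order lf sl (inl u) (inl v)) (map tl ks).
    rewrite pairwise_map; apply: sub_pairwise nks.
    by move=> e f /andP[].
  by apply: pairwise_uniq => u; rewrite ordxx.
have uh : uniq (map hd ks).
  have : pairwise (fun u v => ins_order lf sl (inl v) (inl u)) (map hd ks).
    rewrite pairwise_map; apply: sub_pairwise nks.
    by move=> e f /andP[].
  by apply: pairwise_uniq => u; rewrite ordxx.
pose p e := [exists v, foot lf sl v == Some (tl e)].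
rewrite -(count_predC p ks) -!size_filter; apply: leq_add.
  pose feet := [set v | foot lf sl v != None]%SET.
  have hb : size (seq.filter p ks) <= #|feet|.
    apply: leq_trans (leq_imset_card (foot lf sl) feet).
    rewrite -(size_map (Some \o tl)).
    have /card_uniqP <- : uniq (map (Some \o tl) (seq.filter p ks)).
      rewrite map_comp map_inj_uniq; last by move=> ? ? [].
      by apply: subseq_uniq ut; apply: map_subseq; apply: filter_subseq.
    apply: subset_leq_card; apply/fintype.subsetP => a /mapP[e].
    rewrite mem_filter => /andP[/existsP[v /eqP hv] _] -> /=.
    by rewrite -hv imset_f // inE hv.
  apply: leq_trans hb _.
  have [v1 _ minv] := @arg_minnP V v0 xpredT r isT.
  have : feet \subset ([set v | is_source v] :\ v1)%SET.
    apply/fintype.subsetP => v; rewrite !inE; case bv: (foot lf sl v) => [a|//] _.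
    have [f fa av] := foot_tail sw bv; apply/andP; split.
      by apply/eqP => h; have := minv a isT; rewrite -h leqNgt av.
    move: bv; rewrite /foot; case rv: (last_in lf v) => [//|] _.
    by apply/forallP => e; apply/eqP; apply: (last_in_none lfP rv).
  move/subset_leq_card => /leq_trans; apply.
  have := cardsD1 v1 [set v | is_source v]%SET; rewrite inE.
  suff -> : is_source v1 by rewrite add1n => ->.
  apply/forallP => e; apply/eqP => h; have := minv (tl e) isT.
  by rewrite -h leqNgt (rank_edge lfP).
pose roof v := [pick t | is_roof lf sl sr (inl v) (inl t)].
have roofE v t : is_roof lf sl sr (inl v) (inl t) -> roof v = Some t.
  move=> ht; rewrite /roof; case: pickP => [t' ht'|/(_ t)]; last by rewrite ht.
  congr Some; apply: (rank_inj lfP).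
  case/andP: ht => q /forallP m; case/andP: ht' => q' /forallP m'.
  have := implyP (m _) q'; have := implyP (m' _) q.
  by rewrite /= !leq_double => h1 h2; apply/eqP; rewrite eqn_leq h1 h2.
pose roofs := [set v | is_sink v && (roof v != None)]%SET.
have hb : size (seq.filter (predC p) ks) <= #|roofs|.
  apply: leq_trans (leq_imset_card roof roofs).
  rewrite -(size_map (Some \o hd)).
  have /card_uniqP <- : uniq (map (Some \o hd) (seq.filter (predC p) ks)).
    rewrite map_comp map_inj_uniq; last by move=> ? ? [].
    by apply: subseq_uniq uh; apply: map_subseq; apply: filter_subseq.
  apply: subset_leq_card; apply/fintype.subsetP => a /mapP[e].
  rewrite mem_filter => /andP[/= /existsPn np eks] -> /=.
  have [[v hv]|[v sv tv]] := bypassed_charge (allP kks _ eks).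
    by have := np v; rewrite hv eqxx.
  by rewrite -(roofE _ _ tv) imset_f // inE sv (roofE _ _ tv).
apply: leq_trans hb _.
have [v1 _ maxv] := @arg_maxnP V v0 xpredT r isT.
have : roofs \subset ([set v | is_sink v] :\ v1)%SET.
  apply/fintype.subsetP => v; rewrite !inE; case/andP=> sv; rewrite sv andbT /roof.
  case: pickP => [t /andP[/(below_start sw) vt _] _|//].
  apply/eqP => h; have := maxv t isT; move: vt.
  by rewrite h /= ltn_double /= ltnNge => /negPf ->.
move/subset_leq_card => /leq_trans; apply.
have := cardsD1 v1 [set v | is_sink v]%SET; rewrite inE.
suff -> : is_sink v1 by rewrite add1n => ->.
apply/forallP => e; apply/eqP => h; have := maxv (hd e) isT.
by rewrite -h /= leqNgt (rank_edge lfP).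
Qed.
End Count.
End Sweep.

(** * From drawings to left-to-right relations *)
Section Curves.
Variable R : realType.
Local Open Scope classical_set_scope.
Local Open Scope ring_scope.

Lemma within_continuous_comp_in (S U W : topologicalType) (A : set S) (B : set U)
    (f : S -> U) (g : U -> W) : (forall x, A x -> B (f x)) ->
  {within A, continuous f} -> {within B, continuous g} ->
  {within A, continuous (g \o f)}.
Proof.
move=> AB /subspace_continuousP cf /subspace_continuousP cg.
apply/subspace_continuousP => x Ax P /(cg _ (AB _ Ax)).
move=> /(cf _ Ax) cfP.
change (nbhs x (fun z => A z -> B (f z) -> P (g (f z)))) in cfP.
change (nbhs x (fun z => A z -> P (g (f z)))).
by apply: filterS cfP => z h Az; apply: h => //; apply: AB.
Qed.

(** The height is strictly increasing along the curve, so it can be used as the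
    parameter; the inverse of a continuous increasing bijection between segments
    is continuous. *)
Lemma upward_curve_graph (p q : R * R) (g : R -> R * R) :
  {within `[0, 1], continuous g} -> g 0 = p -> g 1 = q ->
  {in `[0, 1] &, forall s t : R, s < t -> (g s).2 < (g t).2} ->
  p.2 < q.2 /\
  exists f : R -> R, [/\ {within `[p.2, q.2], continuous f},
    f p.2 = p.1, f q.2 = q.1 &
    forall h, p.2 <= h <= q.2 -> exists2 t, t \in `[0, 1] & g t = (f h, h)].
Proof.
move=> cg <- <- inc.
pose k t := (g t).2.
have in0 : (0 : R) \in `[0, 1] by rewrite in_itv /= lexx ler01.
have in1 : (1 : R) \in `[0, 1] by rewrite in_itv /= lexx ler01.
split; first exact: inc.
have ck : {within `[0, 1], continuous k}.
  apply: (@within_continuous_comp_in _ _ _ _ setT g snd) => //.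
  by apply: continuous_subspaceT => x; apply: cvg_snd.
have kinj : {in `[0, 1] &, injective k}.
  move=> s t hs ht kst; case: (ltgtP s t) => // h.
    by have := inc _ _ hs ht h; rewrite /k in kst; rewrite kst ltxx.
  by have := inc _ _ ht hs h; rewrite /k in kst; rewrite kst ltxx.
have kivt h : k 0 <= h <= k 1 -> exists2 t, t \in `[0, 1] & k t = h.
  move=> hh; have k01 : k 0 <= k 1 by case/andP: hh => /le_trans; apply.
  apply: (IVT ler01 ck); rewrite min_l // max_r //.
pose inv h := get [set t | t \in `[0, 1] /\ k t = h].
have invP t : t \in `[0, 1] -> inv (k t) = t.
  move=> ht; have : [set s | s \in `[0, 1] /\ k s = k t] (inv (k t)).
    by apply: (@getPex _ [set s | s \in `[0, 1] /\ k s = k t]); exists t.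
  by move=> [/= hs /kinj]; apply.
have inv01 h : k 0 <= h <= k 1 -> inv h \in `[0, 1] /\ k (inv h) = h.
  by move=> /kivt[t ht <-]; rewrite invP.
have cinv : {within `[k 0, k 1], continuous inv}.
  by apply: (@segment_can_le_continuous _ 0 1 k inv) => //; apply: ler01.
exists (fst \o g \o inv); split.
- have cfg : {within `[0, 1], continuous (fst \o g)}.
    apply: (@within_continuous_comp_in _ _ _ _ setT g fst) => //.
    by apply: continuous_subspaceT => x; apply: cvg_fst.
  apply: within_continuous_comp_in cinv cfg => h /=.
  by rewrite in_itv /= => /inv01[].
- by rewrite /= -/(k 0) invP.
- by rewrite /= -/(k 1) invP.
move=> h /inv01[h1 h2]; exists (inv h) => //=.
by rewrite -[X in (_, X)]h2 /k -surjective_pairing.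
Qed.

Lemma graphs_meet (f g : R -> R) (l u a b : R) :
  {within `[l, u], continuous f} -> {within `[l, u], continuous g} ->
  l <= a <= u -> l <= b <= u -> a < b -> (f a < g a) != (f b < g b) ->
  f a != g a -> f b != g b ->
  exists2 h, a < h < b & f h = g h.
Proof.
move=> cf cg /andP[la au] /andP[lb bu] ab sgn fga fgb.
have sub : `[a, b] `<=` `[l, u].
  by move=> x /=; rewrite !in_itv /=; lra.
have cd : {within `[a, b], continuous (fun x => f x - g x)}.
  by apply: within_continuousB; apply: continuous_subspaceW sub _.
have [|h] := IVT (ltW ab) cd (v := 0).
  case: (ltgtP (f a) (g a)) sgn fga => // ha; case: (ltgtP (f b) (g b)) fgb => // hb _ _ _.
    by rewrite ge_min le_max; apply/andP; split; apply/orP; [left|right]; lra.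
  by rewrite ge_min le_max; apply/andP; split; apply/orP; [right|left]; lra.
rewrite in_itv /= => /andP[ah hb] /eqP; rewrite subr_eq0 => /eqP fgh.
exists h => //; rewrite !lt_neqAle ah hb !andbT; apply/andP; split.
  by apply: contra_neq fga => ->.
by apply: contra_neq fgb => <-.
Qed.
End Curves.

Section Geometry.
Local Open Scope ring_scope.
Variables (R : realType) (V E : finType) (tl hd : E -> V).
Variables (px py : V -> R) (f : E -> R -> R).
Hypothesis pos_inj : forall u v, px u = px v -> py u = py v -> u = v.
Hypothesis edge_up : forall e, py (tl e) < py (hd e).
Hypothesis f_cont : forall e, ({within `[py (tl e), py (hd e)], continuous (f e)})%classic.
Hypothesis f_tl : forall e, f e (py (tl e)) = px (tl e).
Hypothesis f_hd : forall e, f e (py (hd e)) = px (hd e).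
Hypothesis f_vertex : forall e v, py (tl e) <= py v <= py (hd e) ->
  f e (py v) = px v -> v = tl e \/ v = hd e.
Hypothesis f_cross : forall e e' h, e != e' ->
  py (tl e) <= h <= py (hd e) -> py (tl e') <= h <= py (hd e') ->
  f e h = f e' h ->
  exists v, [/\ py v = h, v = tl e \/ v = hd e & v = tl e' \/ v = hd e'].

Notation O := (V + E)%type.
Implicit Types (x y z o : O) (e : E) (u v : V).

(** Vertices at the same height are swept from left to right, as if the sweep
    line were slightly tilted. *)
Definition lexlt u v := (py u < py v) || ((py u == py v) && (px u < px v)).
Definition rank v := #|[set u | lexlt u v]|.

Lemma lexlt_trans : transitive lexlt.
Proof.
move=> v u w; rewrite /lexlt => /orP[h1|/andP[/eqP h1 h1']] /orP[h2|/andP[/eqP h2 h2']].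
- by rewrite (lt_trans h1 h2).
- by rewrite -h2 h1.
- by rewrite h1 h2.
- by rewrite h1 h2 eqxx (lt_trans h1' h2') orbT.
Qed.

Lemma lexltxx v : lexlt v v = false.
Proof. by rewrite /lexlt !ltxx andbF. Qed.

Lemma lexlt_total u v : u != v -> lexlt u v || lexlt v u.
Proof.
move=> uv; rewrite /lexlt; case: (ltgtP (py u) (py v)) => //= h.
case: (ltgtP (px u) (px v)) => //= h'.
by move: uv; rewrite (pos_inj h' h) eqxx.
Qed.

Lemma lexlt_rank u v : lexlt u v -> (rank u < rank v)%N.
Proof.
move=> uv; apply: proper_card; apply/properP; split.
  by apply/fintype.subsetP => w; rewrite !inE => /lexlt_trans; apply.
by exists u; rewrite inE // lexltxx.
Qed.

Lemma rank_injective : injective rank.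
Proof.
move=> u v h; apply/eqP; apply: contraT => /lexlt_total/orP[]/lexlt_rank.
  by rewrite h ltnn.
by rewrite h ltnn.
Qed.

Lemma rank_py u v : (rank u <= rank v)%N -> py u <= py v.
Proof.
move=> uv; have [->//|/lexlt_total/orP[/orP[/ltW//|/andP[/eqP-> //]]|]] := eqVneq u v.
by move/lexlt_rank; rewrite ltnNge uv.
Qed.

Definition lo o : R := match o with inl v => py v | inr e => py (tl e) end.
Definition hi o : R := match o with inl v => py v | inr e => py (hd e) end.
Definition at_height o h : R := match o with inl v => px v | inr e => f e h end.
Definition spans o h := lo o <= h <= hi o.

Definition left_at x y : Prop :=
  exists h, [/\ spans x h, spans y h & at_height x h < at_height y h].
Local Notation ov := (overlap tl hd rank).
(** With the tilted line the objects may overlap at a single real height, or touch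
    at a common end, so it takes a common height at which they differ. *)
Definition leftrel : rel O := fun x y => ov x y && `[< left_at x y >].

Lemma rank_up e : (rank (tl e) < rank (hd e))%N.
Proof. by apply: lexlt_rank; rewrite /lexlt edge_up. Qed.

Lemma lo_hi o : lo o <= hi o.
Proof. by case: o => //= e; apply/ltW/edge_up. Qed.

Lemma overlap_lo_hi x y : ov x y -> lo x <= hi y.
Proof.
rewrite /overlap => /andP[+ _].
case: x y => [u|e] [v|e'] /= h; apply: rank_py; lia.
Qed.

(** By planarity a common point is an end of both. An edge overlaps neither its ends
    nor an edge that starts where it stops, so there remain two edges with the
    same tail or with the same head. *)
Lemma contact x y h : x != y -> ov x y -> spans x h -> spans y h ->
  at_height x h = at_height y h ->
  [/\ lo x = h, lo y = h, h < hi x & h < hi y] \/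
  [/\ hi x = h, hi y = h, lo x < h & lo y < h].
Proof.
case: x y => [u|e] [v|e'] xy oxy; rewrite /spans /= => sx sy.
- move=> uv; case: (negP xy); apply/eqP; congr inl.
  by apply: pos_inj => //; apply/eqP; rewrite eq_le; lra.
- have hu : h = py u by apply/eqP; rewrite eq_le; lra.
  rewrite hu in sy *; move/esym/(f_vertex sy) => uv; exfalso.
  move: oxy; rewrite /overlap /=; have := rank_up e'.
  by case: uv => ->; lia.
- have hu : h = py v by apply/eqP; rewrite eq_le; lra.
  rewrite hu in sx *; move/(f_vertex sx) => uv; exfalso.
  move: oxy; rewrite /overlap /=; have := rank_up e.
  by case: uv => ->; lia.
move=> ff; have ee' : e != e' by apply: contra_neq xy => ->.
have [w [<- we we']] := f_cross ee' sx sy ff.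
have := edge_up e; have := edge_up e'; have := rank_up e; have := rank_up e'.
move: oxy; rewrite /overlap /=.
case: we we' => -> [] h' => o r1 r2 y1 y2.
- by left; rewrite h' in y2 *.
- by exfalso; rewrite h' in o r2; lia.
- by exfalso; rewrite h' in o r2; lia.
- by right; rewrite h' in y2 *.
Qed.

Lemma spans_inter2 x y : ov x y -> exists l u : R,
  [/\ l <= u, (forall h, l <= h <= u -> spans x h && spans y h),
   l = lo x \/ l = lo y & u = hi x \/ u = hi y].
Proof.
move=> oxy; have oyx : ov y x by rewrite overlapC.
have h1 := overlap_lo_hi oxy; have h2 := overlap_lo_hi oyx.
have h3 := lo_hi x; have h4 := lo_hi y.
exists (Num.max (lo x) (lo y)), (Num.min (hi x) (hi y)); split.
- by rewrite le_min !ge_max h1 h2 h3 h4.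
- by move=> h; rewrite le_min ge_max /spans => /andP[/andP[-> ->] /andP[-> ->]].
- by rewrite maxEle; case: ifP; [right|left].
- by rewrite minEle; case: ifP; [left|right].
Qed.

(** By [contact] two overlapping edges do not meet inside their common range of
    heights, so by the intermediate value theorem they keep their sides. For
    totality and transitivity look at the middle of the common range. If the
    objects meet there, then they are edges that all start, or all end, at this
    height; but the common range of such edges extends beyond the height and
    does not have it as its middle. *)
Lemma leftrel_leftness : leftness tl hd rank leftrel.
Proof.
have asym x y : leftrel x y -> ~~ leftrel y x.
  move=> /andP[oxy /asboolP[h [hx hy hxy]]]; apply/negP.
  move=> /andP[_ /asboolP[k [ky kx kyx]]].
  have xy : x != y by apply/eqP => e; rewrite e ltxx in hxy.
  case: x y oxy hx hy hxy ky kx kyx xy => [u|e] [v|e'] oxy hx hy hxy ky kx kyx xy.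
  - by move: (lt_trans hxy kyx); rewrite ltxx.
  - have hk : h = k by move: hx kx; rewrite /spans /=; lra.
    by rewrite hk in hxy; move: (lt_trans hxy kyx); rewrite ltxx.
  - have hk : h = k by move: hy ky; rewrite /spans /=; lra.
    by rewrite hk in hxy; move: (lt_trans hxy kyx); rewrite ltxx.
  have [l [u [lu sp le ue]]] := spans_inter2 oxy.
  have cf (g : E) : (g = e) \/ (g = e') -> ({within `[l, u], continuous (f g)})%classic.
    move=> ge; apply: continuous_subspaceW (f_cont (e := g)) => t /=.
    rewrite !in_itv /= => /sp; rewrite /spans /=.
    by case: ge => -> /andP[].
  have inlu t : spans (inr e) t -> spans (inr e') t -> l <= t <= u.
    by rewrite /spans /=; case: le => ->; case: ue => -> /=; lra.
  have neq t : at_height (inr e) t < at_height (inr e') t \/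
      at_height (inr e') t < at_height (inr e) t -> f e t != f e' t.
    by case=> /= h'; [rewrite lt_eqF|rewrite gt_eqF].
  have nh := neq h (or_introl hxy); have nk := neq k (or_intror kyx).
  have sg : (f e h < f e' h) != (f e k < f e' k).
    by rewrite [X in X != _]hxy ltNge (ltW kyx).
  have hk : h != k.
    by apply/eqP => hk; move: hxy; rewrite hk => /(lt_trans kyx); rewrite ltxx.
  have [c [ch cc]] : exists c, (h < c < k \/ k < c < h) /\ f e c = f e' c.
    have cfe := cf e (or_introl erefl); have cfe' := cf e' (or_intror erefl).
    have hlu := inlu _ hx hy; have klu := inlu _ kx ky.
    have [hk'|hk'|hk'] := ltgtP h k; last by rewrite hk' eqxx in hk.
      by have [c hc fc] := graphs_meet cfe cfe' hlu klu hk' sg nh nk; exists c; split=> //; left.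
    rewrite eq_sym in sg.
    by have [c hc fc] := graphs_meet cfe cfe' klu hlu hk' sg nk nh; exists c; split=> //; right.
  have sx : spans (inr e) c by case: ch hx kx => ch; move: ch; rewrite /spans; lra.
  have sy : spans (inr e') c by case: ch hy ky => ch; move: ch; rewrite /spans; lra.
  move: hx kx; rewrite /spans => /andP[hx1 hx2] /andP[kx1 kx2].
  have C := contact xy oxy sx sy cc.
  clear -C ch hx1 hx2 kx1 kx2.
  case: C => -[c1 _ _ _]; case: ch => /andP[ch1 ch2]; lra.
have total x y : x != y -> ov x y -> leftrel x y || leftrel y x.
  move=> xy oxy; rewrite /leftrel (overlapC _ _ _ y) oxy /=.
  have [l [u [lu sp le ue]]] := spans_inter2 oxy.
  pose m := (l + u) / 2; have lmu : l <= m <= u by rewrite /m; lra.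
  have /andP[mx my] := sp _ lmu.
  have [h|h|h] := ltgtP (at_height x m) (at_height y m).
  - by apply/orP; left; apply/asboolP; exists m.
  - by apply/orP; right; apply/asboolP; exists m.
  exfalso; have C := contact xy oxy mx my h; rewrite /m in C.
  clear -C le ue; case: C => -[c1 c2 c3 c4]; case: le => le; case: ue => ue; lra.
have weak x y h : leftrel x y -> spans x h -> spans y h ->
    at_height x h <= at_height y h.
  move=> xy hx hy; rewrite leNgt; apply/negP => yx; move/asym: (xy); rewrite /leftrel.
  case/andP: xy => oxy _; rewrite overlapC oxy /= => /asboolP; apply.
  by exists h.
have neq x y : leftrel x y -> x != y.
  by move=> xy; apply/eqP => e; subst y; have := asym _ _ xy; rewrite xy.
have ends e v o : v = tl e \/ v = hd e ->
    (leftrel o (inl v) -> leftrel o (inr e)) /\ (leftrel (inl v) o -> leftrel (inr e) o).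
  move=> ve.
  have oe : ov o (inl v) -> o != inl v -> ov o (inr e).
    have := rank_up e; rewrite /overlap; case: o => [v'|e'] /= re h ov.
      have vv : rank v' != rank v.
        by apply: contra_neq ov => /rank_injective->.
      by exfalso; lia.
    by case: ve => ve; rewrite ve in h; lia.
  have fe : f e (py v) = px v by case: ve => ->; rewrite ?f_tl ?f_hd.
  have se : spans (inr e) (py v).
    by rewrite /spans /=; case: ve => ->; rewrite lexx ltW.
  split=> /[dup] /neq nv /andP[oo /asboolP[h [h1 h2 h3]]].
    have hv : h = py v by apply/eqP; rewrite eq_le andbC; exact: h2.
    apply/andP; split; first exact: oe.
    by apply/asboolP; exists h; split=> //; rewrite hv //= fe -hv.
  have hv : h = py v by apply/eqP; rewrite eq_le andbC; exact: h1.
  apply/andP; split; first by rewrite overlapC; apply: oe; rewrite 1?overlapC // eq_sym.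
  by apply/asboolP; exists h; split=> //; rewrite hv //= fe -hv.
split.
- exact: rank_injective.
- exact: rank_up.
- by move=> x y /andP[].
- exact: total.
- exact: asym.
- move=> x y z xy yz oxz.
  have xz : x != z.
    by apply/eqP => xz; move: (asym _ _ xy); rewrite xz yz.
  have /orP[//|zx] := total _ _ xz oxz; exfalso.
  have oxy : ov x y by case/andP: xy.
  have oyz : ov y z by case/andP: yz.
  pose l := Num.max (lo x) (Num.max (lo y) (lo z)).
  pose u := Num.min (hi x) (Num.min (hi y) (hi z)).
  have bnd : forall a b, ov a b -> lo a <= hi b /\ lo b <= hi a.
    by move=> a b ab; split; apply: overlap_lo_hi; rewrite // overlapC.
  have [h1 h2] := bnd _ _ oxy; have [h3 h4] := bnd _ _ oyz; have [h5 h6] := bnd _ _ oxz.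
  have h7 := lo_hi x; have h8 := lo_hi y; have h9 := lo_hi z.
  have lu : l <= u by rewrite /l /u !le_min !ge_max !(h1, h2, h3, h4, h5, h6, h7, h8, h9).
  pose m := (l + u) / 2.
  have [lm um] : l <= m /\ m <= u by rewrite /m; split; lra.
  have [mx my mz] : [/\ spans x m, spans y m & spans z m].
    move: lm um; rewrite /l /u !ge_max !le_min /spans.
    by move=> /and3P[-> -> ->] /and3P[-> -> ->].
  have exy : at_height x m = at_height y m.
    have := weak _ _ _ xy mx my; have := weak _ _ _ yz my mz; have := weak _ _ _ zx mz mx.
    by move=> a1 a2 a3; apply/eqP; rewrite eq_le a3 (le_trans a2 a1).
  have eyz : at_height y m = at_height z m.
    have := weak _ _ _ yz my mz; have := weak _ _ _ zx mz mx.
    by move=> a1 a2; apply/eqP; rewrite eq_le a2 -exy a1.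
  have C1 := contact (neq _ _ xy) oxy mx my exy.
  have C2 := contact (neq _ _ yz) oyz my mz eyz.
  have ml : l = lo x \/ l = lo y \/ l = lo z.
    by rewrite /l; case: (leP (lo y) (lo z)) => _; case: (leP (lo x) _) => _; auto.
  have mu : u = hi x \/ u = hi y \/ u = hi z.
    by rewrite /u; case: (leP (hi y) (hi z)) => _; case: (leP (hi x) _) => _; auto.
  clear - C1 C2 ml mu lm um lu.
  rewrite /m in C1 C2; case: C1 => -[a1 a2 a3 a4]; case: C2 => -[b1 b2 b3 b4];
    case: ml => [ml|[ml|ml]]; case: mu => [mu|[mu|mu]]; lra.
- by move=> e o; apply: (ends e (tl e) o _).1; left.
- by move=> e o; apply: (ends e (tl e) o _).2; left.
- by move=> e o; apply: (ends e (hd e) o _).1; right.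
- by move=> e o; apply: (ends e (hd e) o _).2; right.
Qed.
End Geometry.

(** * The upper bound *)
Section UpperBound.
Variables (d : Order.disp_t) (T : finPOrderType d).
Implicit Types x y : T.

Definition minimals : {set T} := [set x | [forall y : T, ~~ (y < x)%O]]%SET.
Definition maximals : {set T} := [set x | [forall y : T, ~~ (x < y)%O]]%SET.

Lemma lt_cover_ind (Q : T -> T -> Prop) :
  (forall x y, cover_rel x y -> Q x y) ->
  (forall x y z, Q x y -> Q y z -> Q x z) ->
  forall x y, (x < y)%O -> Q x y.
Proof.
move=> Qc Qt x y.
have [n] := ubnP #|[set z | (x < z)%O && (z < y)%O]%SET|.
elim: n x y => // n IH x y hn xy.
have [/existsP[z /andP[xz zy]]|nz] := boolP [exists z, (x < z)%O && (z < y)%O]; last first.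
  by apply: Qc; rewrite /cover_rel xy.
rewrite ltnS in hn; apply: (Qt _ z); apply: IH => //; apply: leq_trans hn;
  apply: proper_card; apply/properP; (split; last by exists z; rewrite !inE ?xz ?zy ?ltxx ?andbF);
  apply/fintype.subsetP => w; rewrite !inE.
  by move=> /andP[-> /lt_trans]; apply.
by move=> /andP[/(lt_trans xz) -> ->].
Qed.

Lemma exists_cover_below x y : (x < y)%O -> exists z : T, cover_rel z y.
Proof.
move: x y; apply: (@lt_cover_ind (fun _ y => exists z : T, cover_rel z y)) => //.
by move=> x y xy; exists x.
Qed.

Lemma exists_cover_above x y : (x < y)%O -> exists z : T, cover_rel x z.
Proof.
move: x y; apply: (@lt_cover_ind (fun x _ => exists z : T, cover_rel x z)) => //.
by move=> x y xy; exists y.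
Qed.

Lemma card_antichain (A : {set T}) : antichain A -> #|A| <= width T.
Proof. by move=> hA; apply: (leq_bigmax_cond (F := fun A : {set T} => #|A|)). Qed.

Lemma antichainP (A : {set T}) :
  (forall x y, x \in A -> y \in A -> ~~ (x < y)%O) -> antichain A.
Proof.
move=> h; apply/forall_inP => x xA; apply/forall_inP => y yA; apply/implyP => xy.
apply/negP => /orP[]; rewrite le_eqVlt.
  by rewrite (negPf xy) /= (negPf (h _ _ xA yA)).
by rewrite eq_sym (negPf xy) /= (negPf (h _ _ yA xA)).
Qed.

Lemma minimals_width : #|minimals| <= width T.
Proof.
apply: card_antichain; apply: antichainP => x y _; rewrite inE => /forallP; exact.
Qed.

Lemma maximals_width : #|maximals| <= width T.
Proof.
apply: card_antichain; apply: antichainP => x y; rewrite inE => /forallP + _; exact.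
Qed.

Lemma queue_number_le k : queue_layout T k -> queue_number T <= k.
Proof.
by move=> h; rewrite /queue_number; case: ex_minnP => m _; apply; apply/asboolP.
Qed.

Definition covers := {c : T * T | cover_rel c.1 c.2}.
Definition tail (e : covers) : T := (val e).1.
Definition head (e : covers) : T := (val e).2.

(** The left-first order, restricted to the elements of the poset, is the linear
    extension of the layout. *)
Lemma queue_layout_sweep (r : T -> nat) (lf : rel (T + covers)) (x0 : T) :
  leftness tail head r lf ->
  queue_layout T (width T + (#|minimals|.-1 + #|maximals|.-1)).
Proof.
move=> lfP.
pose sl v := tail_time tail r (left_nbr lf v) <= tail_time tail r (left_nbr (converse lf) v).
have sw : sweep tail head r lf sl (predC sl).
  by split=> // v /=; rewrite /sl -ltnNge => /ltnW.
pose L := ins_order tail head r lf sl.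
pose Q := below tail head r lf sl (predC sl).
have QP (x y : T) : (x < y)%O -> Q (inl x) (inl y).
  move: x y; apply: lt_cover_ind => [x y xy|x y z]; last exact: below_trans.
  exact: (tl_below_hd sw (exist _ (x, y) xy)).
have LP (x y : T) : (x < y)%O -> L (inl x) (inl y) by move=> /QP/andP[].
exists (fun x y => (x == y) || L (inl x) (inl y)); split.
  split.
  - move=> x y; have [->//|xy] := eqVneq x y.
    by rewrite /= /L [ins_order _ _ _ _ _ (inl x) _](ordNC _ lfP) ?orNb // .
  - move=> x y /andP[/predU1P[//|xy] /predU1P[//|yx]].
    by have := ord_asym lfP xy; rewrite -/L yx.
  - move=> y x z /predU1P[->//|xy] /predU1P[<-|yz]; first by rewrite xy orbT.
    by rewrite /L (ord_trans lfP xy yz) orbT.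
  - by move=> x y xy; rewrite /strict_rel (lt_eqF xy) LP // orbT.
case=> s [ss /andP[/all_sigP[es es_s] srt]].
pose L1 (x y : T) := L (inl x) (inl y).
have L1tr : transitive L1 by move=> y x z; apply: ord_trans.
have strictE : strict_rel (fun x y => (x == y) || L (inl x) (inl y)) =2 L1.
  move=> x y; rewrite /strict_rel /L1; have [->|] //= := eqVneq x y.
  by rewrite /L ordxx.
move: srt; rewrite (eq_sorted strictE) => /cat_sorted2[srt1 srt2].
have nst : pairwise (nests tail head r lf sl) es.
  suff : pairwise [rel e f | L1 (tail e) (tail f) && L1 (head f) (head e)] es by [].
  rewrite (pairwise_relI (fun e f => L1 (tail e) (tail f)) (fun e f => L1 (head f) (head e))).
  move: srt1 srt2; rewrite rev_sorted !sorted_pairwise //;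
    last by move=> y x z /[swap]; apply: L1tr.
  by rewrite es_s -!map_comp !pairwise_map => -> ->.
have : size es = (width T + (#|minimals|.-1 + #|maximals|.-1)).+1.
  by rewrite -ss es_s size_map.
have : size es <= width T + (#|[set v | is_source head v]%SET|.-1 +
                             #|[set v | is_sink tail v]%SET|.-1).
  apply: (@nested_size _ _ tail head r lf sl (predC sl) (fun x y => (x < y)%O) sw) => //.
  - by move=> y x z; apply: lt_trans.
  - by case=> -[x y] xy; case/andP: (xy).
  - case=> -[x y] xy z xz; case/andP: (xy) => _ /existsPn/(_ z).
    by rewrite [(_ < z)%O]xz.
  - case=> -[x y] xy [[x' y'] xy'] /= h1 h2; apply: val_inj.
    by rewrite /= /tail /head /= in h1 h2 *; rewrite h1 h2.
  move=> A hA; apply: card_antichain; apply: antichainP => x y xA yA.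
  by apply/negP => /QP; rewrite /Q (negPf (hA _ _ xA yA)).
move=> h1 h2;
  suff : (width T + (#|minimals|.-1 + #|maximals|.-1)).+1 <=
         width T + (#|minimals|.-1 + #|maximals|.-1).
  by rewrite ltnn.
rewrite -h2; apply: leq_trans h1 _; rewrite leq_add2l.
apply: leq_add; rewrite -!subn1 leq_sub2r //; apply: subset_leq_card;
  apply/fintype.subsetP => v; rewrite !inE.
  move=> /forallP sv; apply/forallP => u; apply/negP => /exists_cover_below[z zv].
  by have := sv (exist _ (z, v) zv); rewrite /head /= eqxx.
move=> /forallP sv; apply/forallP => u; apply/negP => /exists_cover_above[z zv].
by have := sv (exist _ (v, z) zv); rewrite /tail /= eqxx.
Qed.

Local Open Scope ring_scope.

Lemma planar_leftness (R : realType) : planar R T ->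
  exists (r : T -> nat) (lf : rel (T + covers)), leftness tail head r lf.
Proof.
case=> pos [g [[pos_inj dg] cf]].
pose px (v : T) := (pos v).1; pose py (v : T) := (pos v).2.
have up (e : covers) : upward_curve (pos (tail e)) (pos (head e)) (g (tail e) (head e)).
  by case: e => -[a b] ab; case: (dg _ _ ab).
have graph (e : covers) : exists f : R -> R,
    [/\ {within `[py (tail e), py (head e)], continuous f}%classic,
    f (py (tail e)) = px (tail e), f (py (head e)) = px (head e) &
    forall h, py (tail e) <= h <= py (head e) ->
      exists2 t, t \in `[0, 1] & g (tail e) (head e) t = (f h, h)].
  by case: (up e) => c1 c2 c3 c4; case: (upward_curve_graph c1 c2 c3 c4).
have {graph} [f fP] := choice graph.
exists (rank px py), (leftrel tail head px py f).
apply: leftrel_leftness.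
- move=> u v h1 h2; apply: pos_inj.
  rewrite (surjective_pairing (pos u)) (surjective_pairing (pos v)).
  by rewrite -/(px u) -/(py u) h1 h2.
- by move=> e; case: (up e) => c1 c2 c3 c4; case: (upward_curve_graph c1 c2 c3 c4).
- by move=> e; case: (fP e).
- by move=> e; case: (fP e).
- by move=> e; case: (fP e).
- move=> e v hv fv; case: (fP e) => _ _ _ /(_ _ hv)[t t01 gt].
  move: e hv fv t01 gt => [[a b] ab] hv fv t01 gt.
  case: (dg a b ab) => _ /(_ t t01 v); apply.
  by rewrite /tail /head /= in gt fv; rewrite gt fv -surjective_pairing.
move=> e e' h ee' he he' ff.
case: (fP e) => _ _ _ /(_ _ he)[t t01 gt].
case: (fP e') => _ _ _ /(_ _ he')[t' t01' gt'].
have ne : (tail e, head e) <> (tail e', head e').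
  move=> [h1 h2]; case/eqP: ee'; apply: val_inj.
  by rewrite (surjective_pairing (val e)) (surjective_pairing (val e')) -/(tail e) -/(head e) h1 h2.
have ce : cover_rel (tail e) (head e) by case: (e).
have ce' : cover_rel (tail e') (head e') by case: (e').
have gg : g (tail e) (head e) t = g (tail e') (head e') t' by rewrite gt gt' ff.
have [v [v1 v2 v3]] := cf _ _ _ _ ce ce' ne t t' t01 t01' gg.
by exists v; split=> //; rewrite /py -v3 gt.
Qed.

Theorem planar_queue_number (R : realType) (x0 : T) : planar R T ->
  (queue_number T <= width T + (#|minimals|.-1 + #|maximals|.-1))%N.
Proof.
by move=> /planar_leftness[r [lf lfP]]; apply/queue_number_le/(queue_layout_sweep x0 lfP).
Qed.
End UpperBound.

(** * Posets with a forced rainbow *)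

Inductive tower (T : Type) := Bot | Low of T | High of T | Side | Top.
Arguments Bot {T}. Arguments Side {T}. Arguments Top {T}.

Definition tower_code T (p : tower T) : T + T + option bool :=
  match p with
  | Low x => inl (inl x) | High x => inl (inr x)
  | Side => inr None | Bot => inr (Some false) | Top => inr (Some true)
  end.
Definition tower_decode T (c : T + T + option bool) : tower T :=
  match c with
  | inl (inl x) => Low x | inl (inr x) => High x
  | inr None => Side | inr (Some false) => Bot | inr (Some true) => Top
  end.
Lemma tower_codeK T : cancel (@tower_code T) (@tower_decode T).
Proof. by case. Qed.

HB.instance Definition _ (T : finType) :=
  Finite.copy (tower T) (can_type (@tower_codeK T)).

Section TowerOrder.
Variables (d : Order.disp_t) (T : finPOrderType d).
Local Open Scope order_scope.

Definition tower_le (p q : tower T) : bool :=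
  match p, q with
  | Bot, _ | _, Top | Side, Side | Low _, High _ => true
  | Low x, Low y | High x, High y => x <= y
  | _, _ => false
  end.

Lemma tower_le_refl : reflexive tower_le.
Proof. by case=> //= x; apply: lexx. Qed.

Lemma tower_le_anti : antisymmetric tower_le.
Proof. by case=> [|x|x||] [|y|y||] //= /le_anti->. Qed.

Lemma tower_le_trans : transitive tower_le.
Proof. by case=> [|x|x||] [|y|y||] [|z|z||] //=; apply: le_trans. Qed.

HB.instance Definition _ :=
  Order.Le_isPOrder.Build d (tower T) tower_le_refl tower_le_anti tower_le_trans.
End TowerOrder.

Section Tower.
Variables (d : Order.disp_t) (T : finPOrderType d) (b t : T).
Hypothesis b_min : forall x, (b <= x)%O.
Hypothesis t_max : forall x, (x <= t)%O.
Local Open Scope order_scope.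
Notation TT := (tower T).

Lemma tower_leE (p q : TT) : (p <= q) = tower_le p q. Proof. by []. Qed.
Lemma tower_ltE (p q : TT) : (p < q) = (q != p) && tower_le p q.
Proof. by rewrite lt_def. Qed.

Lemma Low_inj : injective (@Low T). Proof. by move=> x y []. Qed.
Lemma High_inj : injective (@High T). Proof. by move=> x y []. Qed.

Lemma Low_lt x y : (Low x < Low y :> TT) = (x < y).
Proof. by rewrite tower_ltE (inj_eq Low_inj) /= -lt_def. Qed.
Lemma High_lt x y : (High x < High y :> TT) = (x < y).
Proof. by rewrite tower_ltE (inj_eq High_inj) /= -lt_def. Qed.

Inductive tower_cover : TT -> TT -> Prop :=
| CoverBotLow : tower_cover Bot (Low b)
| CoverLow x y of cover_rel x y : tower_cover (Low x) (Low y)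
| CoverLowHigh : tower_cover (Low t) (High b)
| CoverHigh x y of cover_rel x y : tower_cover (High x) (High y)
| CoverHighTop : tower_cover (High t) Top
| CoverBotSide : tower_cover Bot Side
| CoverSideTop : tower_cover Side Top.

Lemma cover_no_between (S : finPOrderType d) (p q r : S) : cover_rel p q -> p < r -> r < q -> False.
Proof. by move=> /andP[_ /existsPn/(_ r)] h pr rq; rewrite pr rq in h. Qed.

Lemma cover_tower p q : cover_rel p q -> tower_cover p q.
Proof.
move=> /[dup] cpq /andP[pq _].
have no r : p < r -> r < q -> False := cover_no_between cpq.
have bx x : x = b \/ b < x.
  by have := b_min x; rewrite le_eqVlt => /predU1P[->|]; [left|right].
have tx x : x = t \/ x < t.
  by have := t_max x; rewrite le_eqVlt => /predU1P[->|]; [left|right].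
case: p q pq cpq no => [|x|x||] [|y|y||] pq cpq no; rewrite tower_ltE ?andbF //= in pq.
- have [->|yb] := bx y; first by constructor.
  by case: (no (Low b)); rewrite ?Low_lt.
- by case: (no (Low b)).
- by constructor.
- by case: (no Side).
- constructor; rewrite /cover_rel -Low_lt tower_ltE pq /=.
  by apply/existsPn => z; apply/negP => /andP[xz zy]; apply: (no (Low z)); rewrite Low_lt.
- have [->|xt] := tx x; last by case: (no (Low t)); rewrite ?Low_lt.
  have [->|yb] := bx y; first by constructor.
  by case: (no (High b)); rewrite ?High_lt.
- by case: (no (High b)).
- constructor; rewrite /cover_rel -High_lt tower_ltE pq /=.
  by apply/existsPn => z; apply/negP => /andP[xz zy]; apply: (no (High z)); rewrite High_lt.
- have [->|xt] := tx x; first by constructor.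
  by case: (no (High t)); rewrite ?High_lt.
by constructor.
Qed.

Lemma tower_cover_cover p q : tower_cover p q -> cover_rel p q.
Proof.
have mk (p' q' : TT) : p' < q' -> (forall r, p' < r -> r < q' -> False) -> cover_rel p' q'.
  move=> h no; rewrite /cover_rel h; apply/existsPn => r.
  by apply/negP => /andP[]; apply: no.
have bmin x : (x < b) = false by apply/negP => h; have := lt_le_trans h (b_min x); rewrite ltxx.
have tmax x : (t < x) = false by apply/negP => h; have := lt_le_trans h (t_max x); rewrite ltxx.
case=> [|x y xy||x y xy|||]; apply: mk; rewrite ?Low_lt ?High_lt //.
- by case=> [|z|z||] //; rewrite Low_lt bmin.
- by case/andP: xy.
- by case=> [|z|z||] //; rewrite !Low_lt; apply: cover_no_between.
- by case=> [|z|z||] //; rewrite ?Low_lt ?High_lt ?tmax ?bmin.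
- by case/andP: xy.
- by case=> [|z|z||] //; rewrite !High_lt; apply: cover_no_between.
- by case=> [|z|z||] //; rewrite ?High_lt ?tmax.
- by case=> [|z|z||].
- by case=> [|z|z||].
Qed.

(** Away from the bottom and the top, an antichain meets only one of the copies,
    and contains at most [Side] besides. *)
Lemma tower_antichain (w : nat) (A : {set TT}) :
  width T <= w -> antichain A -> (#|A| <= w.+1)%N.
Proof.
move=> Tw hA.
have inc p q : p \in A -> q \in A -> p != q -> tower_le p q -> False.
  move=> pA qA pq ple; move: hA => /forall_inP/(_ p pA)/forall_inP/(_ q qA).
  by rewrite pq /= /Order.comparable tower_leE ple.
have sing p : p \in A -> (forall q, tower_le p q || tower_le q p) -> (#|A| <= w.+1)%N.
  move=> pA pc; apply: (@leq_trans #|[set p]%SET|); last by rewrite cards1.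
  apply: subset_leq_card; apply/fintype.subsetP => q qA; rewrite inE; apply/negPn/negP => qp.
  by case/orP: (pc q) => /inc; apply; rewrite // eq_sym.
have [/sing|BA] := boolP (Bot \in A); first by apply.
have [/sing|TA] := boolP (Top \in A); first by apply; case.
have copy (c : T -> TT) : injective c -> (forall x y, tower_le (c x) (c y) = (x <= y)) ->
    A \subset (Side |: [set c x | x in [set x | c x \in A]])%SET -> (#|A| <= w.+1)%N.
  move=> cinj cle /subset_leq_card sub; apply: leq_trans sub _.
  rewrite cardsU1 -add1n; apply: leq_add; first by case: (_ \notin _).
  rewrite card_imset //; apply: leq_trans Tw; apply: card_antichain; apply: antichainP.
  move=> x y; rewrite !inE => xA yA; apply/negP => xy.
  by apply: (inc _ _ xA yA); rewrite ?cle ?(ltW xy) // (inj_eq cinj) lt_eqF.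
have [/existsP[x xA]|nl] := boolP [exists x, Low x \in A].
  apply: (copy (@Low T)) => //; first exact: Low_inj.
  apply/fintype.subsetP => -[|y|y||] pA; rewrite ?inE //.
  - by rewrite pA in BA.
  - by apply/orP; right; apply/imsetP; exists y; rewrite ?inE.
  - by case: (inc _ _ xA pA).
  - by rewrite pA in TA.
apply: (copy (@High T)) => //; first exact: High_inj.
apply/fintype.subsetP => -[|y|y||] pA; rewrite ?inE //.
- by rewrite pA in BA.
- by case/existsP: nl; exists y.
- by apply/orP; right; apply/imsetP; exists y; rewrite ?inE.
- by rewrite pA in TA.
Qed.

(** If [Side] comes after the top of the lower copy, the cover from [Bot] to [Side]
    encloses that copy; otherwise the cover from [Side] to [Top] encloses the
    upper copy. *)
Lemma tower_rainbow (w : nat) :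
  (forall L : rel T, linear_extension L -> has_rainbow L w) ->
  forall L : rel TT, linear_extension L -> has_rainbow L w.+1.
Proof.
move=> rb L [tot anti tr ext].
have str : transitive (strict_rel L).
  move=> q p r /andP[pq Lpq] /andP[qr Lqr]; rewrite /strict_rel (tr _ _ _ Lpq Lqr) andbT.
  by apply: contra_neq pq => epr; apply: anti; rewrite Lpq epr Lqr.
have inner (c : T -> TT) (p q : TT) : injective c ->
    (forall x y, (c x < c y) = (x < y)) ->
    (forall x y, cover_rel x y -> cover_rel (c x) (c y)) -> cover_rel p q ->
    strict_rel L p q ->
    (forall x, strict_rel L p (c x)) -> (forall x, strict_rel L (c x) q) ->
    has_rainbow L w.+1.
  move=> cinj clt ccov pq Lpq pc cq.
  have [|s [ss /andP[/allP scov ssort]]] := rb (fun x y => L (c x) (c y)).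
    split.
    - by move=> x y; apply: tot.
    - by move=> x y /anti/cinj.
    - by move=> y x z; apply: tr.
    - by move=> x y; rewrite -clt => /ext; rewrite /strict_rel (inj_eq cinj).
  exists ((p, q) :: map (fun e => (c e.1, c e.2)) s); split; first by rewrite /= size_map ss.
  apply/andP; split.
    by rewrite /= pq /=; apply/allP => _ /mapP[e es ->] /=; apply/ccov/scov.
  rewrite /= rev_cons -rcons_cat -!map_comp.
  have -> : [seq (fst \o (fun e => (c e.1, c e.2))) i | i <- s] = map c (map fst s).
    by rewrite -map_comp.
  have -> : [seq (snd \o (fun e => (c e.1, c e.2))) i | i <- s] = map c (map snd s).
    by rewrite -map_comp.
  rewrite -map_rev -map_cat path_pairwise // pairwise_cons pairwise_rcons.
  rewrite all_rcons Lpq /=; apply/and3P; split.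
  - by apply/allP => _ /mapP[x _ ->].
  - by apply/allP => _ /mapP[x _ ->].
  rewrite -sorted_pairwise // sorted_map; apply: sub_sorted ssort => x y.
  by rewrite /strict_rel /= (inj_eq cinj).
have xt x : x = t \/ x < t.
  by have := t_max x; rewrite le_eqVlt => /predU1P[->|]; [left|right].
have [LS|LS] := boolP (L (Low t) Side).
  apply: (inner (@Low T) Bot Side Low_inj Low_lt).
  - by move=> x y xy; apply: tower_cover_cover; constructor.
  - by apply: tower_cover_cover; constructor.
  - exact: ext.
  - by move=> x; apply: ext.
  move=> x; have tS : strict_rel L (Low t) Side by rewrite /strict_rel LS.
  by have [->//|xt'] := xt x; apply: str tS; apply: ext; rewrite Low_lt.
have {LS}St : strict_rel L Side (Low t).
  by have := tot Side (Low t); rewrite (negPf LS) orbF /strict_rel => ->.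
apply: (inner (@High T) Side Top High_inj High_lt).
- by move=> x y xy; apply: tower_cover_cover; constructor.
- by apply: tower_cover_cover; constructor.
- exact: ext.
- by move=> x; apply: str St _; apply: ext.
by move=> x; apply: ext.
Qed.
End Tower.

(** * Straight-line drawings of the towers *)
Section Straight.
Local Open Scope ring_scope.
Variable R : realType.

Definition segment (p q : R * R) (s : R) : R * R :=
  ((1 - s) * p.1 + s * q.1, (1 - s) * p.2 + s * q.2).

Record straight_drawing (d : Order.disp_t) (T : finPOrderType d) (pos : T -> R * R) : Prop :=
  StraightDrawing {
    straight_inj : injective pos;
    straight_up : forall a b, cover_rel a b -> (pos a).2 < (pos b).2;
    straight_vertex : forall a b v s, cover_rel a b -> 0 <= s <= 1 ->
      segment (pos a) (pos b) s = pos v -> v = a \/ v = b;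
    straight_cross : forall a b a' b' s s', cover_rel a b -> cover_rel a' b' ->
      (a, b) <> (a', b') -> 0 <= s <= 1 -> 0 <= s' <= 1 ->
      segment (pos a) (pos b) s = segment (pos a') (pos b') s' ->
      exists v, [/\ v = a \/ v = b, v = a' \/ v = b' &
        segment (pos a) (pos b) s = pos v] }.

Lemma segment_continuous p q : continuous (segment p q).
Proof.
have lin (x y : R) : continuous (fun s : R => (1 - s) * x + s * y).
  move=> s; apply: cvgD; apply: cvgMl_tmp || apply: cvgM; try exact: cvg_cst; try exact: cvg_id.
  by apply: cvgB; [exact: cvg_cst|exact: cvg_id].
move=> s; apply: (@cvg_pair _ _ _ _ (nbhs (segment p q s).1) (nbhs (segment p q s).2)); exact: lin.
Qed.

Lemma straight_planar (d : Order.disp_t) (T : finPOrderType d) (pos : T -> R * R) :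
  straight_drawing pos -> planar R T.
Proof.
case=> inj up vtx cross; exists pos, (fun a b => segment (pos a) (pos b)).
split.
  split=> // a b ab; split; last first.
    by move=> s; rewrite in_itv /= => s01 v; apply: vtx.
  split.
  - by apply: continuous_subspaceT; apply: segment_continuous.
  - by rewrite /segment subr0 !mul1r !mul0r !addr0 -surjective_pairing.
  - by rewrite /segment subrr !mul1r !mul0r !add0r -surjective_pairing.
  - by move=> s s' _ _ ss' /=; have := up _ _ ab; nra.
move=> a b a' b' ab ab' ne s s'; rewrite !in_itv /= => s01 s01' e.
exact: (cross a b a' b' s s').
Qed.
End Straight.

Section TowerDrawing.
Local Open Scope ring_scope.
Variables (R : realType) (d : Order.disp_t) (T : finPOrderType d) (b t : T).
Hypothesis b_min : forall x, (b <= x)%O.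
Hypothesis t_max : forall x, (x <= t)%O.
Variable pos : T -> R * R.
Hypothesis posP : straight_drawing pos.
Hypothesis pos_b : pos b = (0, 0).
Hypothesis pos_t : pos t = (0, 1).
Hypothesis pos_x : forall x, -1 < (pos x).1 < 1.

Definition shrink (k : R) (p : R * R) : R * R := (p.1 / 4 - 1 / 2, p.2 / 5 + k / 5).

Lemma segment_shrink k p q s :
  segment (shrink k p) (shrink k q) s = shrink k (segment p q s).
Proof. by rewrite /segment /shrink /=; congr pair; field. Qed.

Lemma shrink_inj k : injective (shrink k).
Proof.
move=> [x y] [x' y'] [/= h1 h2].
by congr pair; lra.
Qed.

(** The copies are shrunk into the heights 1/5 to 2/5 and 3/5 to 4/5, on the left of
    the vertical axis, [Side] is drawn on the right of it, and only the common
    bottom and top are on the axis. *)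
Definition tower_pos (p : tower T) : R * R :=
  match p with
  | Bot => (0, 0) | Low x => shrink 1 (pos x) | High x => shrink 3 (pos x)
  | Side => (1 / 2, 1 / 2) | Top => (0, 1)
  end.

Lemma pos_up x y : (x < y)%O -> (pos x).2 < (pos y).2.
Proof.
move: x y; apply: lt_cover_ind; first exact: (straight_up posP).
by move=> x y z; apply: lt_trans.
Qed.

Lemma pos_y x : 0 <= (pos x).2 <= 1.
Proof.
apply/andP; split.
  have := b_min x; rewrite le_eqVlt => /predU1P[<-|/pos_up]; first by rewrite pos_b.
  by rewrite pos_b => /ltW.
have := t_max x; rewrite le_eqVlt => /predU1P[->|/pos_up]; first by rewrite pos_t.
by rewrite pos_t => /ltW.
Qed.

Lemma pos_y0 x : (pos x).2 <= 0 -> x = b.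
Proof.
have := b_min x; rewrite le_eqVlt => /predU1P[<-//|/pos_up].
by rewrite pos_b /= ltNge => /negPf->.
Qed.

Lemma pos_y1 x : 1 <= (pos x).2 -> x = t.
Proof.
have := t_max x; rewrite le_eqVlt => /predU1P[//|/pos_up].
by rewrite pos_t /= ltNge => /negPf->.
Qed.

Lemma convex_lt (x y z s : R) : 0 <= s <= 1 -> x < z -> y < z ->
  (1 - s) * x + s * y < z.
Proof.
move=> s01 xz yz; case: (leP s 0) => [|sp].
  by move=> s0; (have -> : s = 0 by lra); lra.
have : 0 < s * (z - y) by apply: mulr_gt0; lra.
have : 0 <= (1 - s) * (z - x) by apply: mulr_ge0; lra.
by lra.
Qed.

Lemma convex_gt (x y z s : R) : 0 <= s <= 1 -> z < x -> z < y ->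
  z < (1 - s) * x + s * y.
Proof.
move=> s01 zx zy; have := @convex_lt (- x) (- y) (- z) s s01.
by rewrite !ltrN2 !mulrN -opprD ltrN2; apply.
Qed.

(** An edge of a copy touches the bottom or the top of its box only at the minimum
    or the maximum of the copy, where the outside edges arrive. *)
Lemma edge_box x y s : cover_rel x y -> 0 <= s <= 1 ->
  let m := segment (pos x) (pos y) s in
  [/\ 0 <= m.2 <= 1, -1 < m.1 < 1,
      m.2 <= 0 -> x = b /\ m = (0, 0) & 1 <= m.2 -> y = t /\ m = (0, 1)].
Proof.
move=> xy s01 /=.
have up := straight_up posP xy.
have yx := pos_y x; have yy := pos_y y; have xx := pos_x x; have xy' := pos_x y.
split.
- have : 0 <= (1 - s) * (pos x).2 by apply: mulr_ge0; lra.
  have : 0 <= s * (pos y).2 by apply: mulr_ge0; lra.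
  have : 0 <= (1 - s) * (1 - (pos x).2) by apply: mulr_ge0; lra.
  have : 0 <= s * (1 - (pos y).2) by apply: mulr_ge0; lra.
  by lra.
- by apply/andP; split; [apply: convex_gt; lra|apply: convex_lt; lra].
- move=> h; have s0 : s = 0.
    case: (leP s 0) => [|sp]; first by lra.
    have : 0 < s * (pos y).2 by apply: mulr_gt0 => //; lra.
    have : 0 <= (1 - s) * (pos x).2 by apply: mulr_ge0; lra.
    by lra.
  have x0 : x = b by apply: pos_y0; rewrite s0 in h; nra.
  by split=> //; rewrite /segment s0 x0 pos_b /=; congr pair; ring.
move=> h; have s1 : s = 1.
  case: (leP 1 s) => [|sp]; first by lra.
  have : 0 < (1 - s) * (1 - (pos x).2) by apply: mulr_gt0; lra.
  have : 0 <= s * (1 - (pos y).2) by apply: mulr_ge0; lra.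
  by lra.
have y1 : y = t by apply: pos_y1; rewrite s1 in h; nra.
by split=> //; rewrite /segment s1 y1 pos_t /=; congr pair; ring.
Qed.

Lemma pair_eq (p q : R * R) : p = q -> p.1 = q.1 /\ p.2 = q.2.
Proof. by move->. Qed.

Ltac by_coordinates e :=
  exfalso; move: (pair_eq e) => /=; clear e; rewrite ?pos_b ?pos_t /=; case;
  repeat match goal with H : is_true (cover_rel _ _) |- _ => clear H end;
  lra.

(** Numbering the kinds of covers halves the pairs to compare in [tower_cross]. *)
Definition cover_index (p q : tower T) : nat :=
  match p, q with
  | Bot, Low _ => 0 | Low _, Low _ => 1 | Low _, High _ => 2 | High _, High _ => 3
  | High _, Top => 4 | Bot, Side => 5 | _, _ => 6
  end%N.

Lemma tower_cross p q p' q' s s' : tower_cover b t p q -> tower_cover b t p' q' ->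
  (cover_index p q <= cover_index p' q')%N -> (p, q) <> (p', q') ->
  0 <= s <= 1 -> 0 <= s' <= 1 ->
  segment (tower_pos p) (tower_pos q) s = segment (tower_pos p') (tower_pos q') s' ->
  exists v, [/\ v = p \/ v = q, v = p' \/ v = q' &
    segment (tower_pos p) (tower_pos q) s = tower_pos v].
Proof.
case=> [|x y xy||x y xy|||]; case=> [|x' y' xy'||x' y' xy'|||] //= _ ne s01 s01';
  rewrite ?segment_shrink ?pos_b ?pos_t //.
- have := edge_box xy' s01'; move: (segment (pos x') _ _) => m /= [m2 m1 m0 _] e.
  have [|xb mb] := m0; first by have [/= e1 e2] := pair_eq e; lra.
  by exists (Low b); split; [right|left; rewrite xb|rewrite e mb /= pos_b].
- by move=> e; by_coordinates e.
- have := edge_box xy' s01'; move: (segment (pos x') _ _) => m /= [m2 m1 _ _] e.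
  by by_coordinates e.
- by move=> e; by_coordinates e.
- move=> e; exists Bot; split; [by left|by left|].
  have [/= e1 e2] := pair_eq e; have -> : s = 0 by lra.
  by rewrite /segment /=; congr pair; ring.
- by move=> e; by_coordinates e.
- move=> /shrink_inj e.
  have ne' : (x, y) <> (x', y') by move=> [h1 h2]; apply: ne; rewrite h1 h2.
  have [v [v1 v2 v3]] := straight_cross posP xy xy' ne' s01 s01' e.
  exists (Low v); split; last by rewrite v3.
    by case: v1 => ->; [left|right].
  by case: v2 => ->; [left|right].
- have := edge_box xy s01; move: (segment (pos x) _ _) => m /= [m2 m1 _ m3] e.
  have [|yt mt] := m3; first by have [/= e1 e2] := pair_eq e; lra.
  by exists (Low t); split; [right; rewrite yt|left|rewrite mt /= pos_t].
- have := edge_box xy s01; move: (segment (pos x) _ _) => m /= [m2 m1 _ _].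
  have := edge_box xy' s01'; move: (segment (pos x') _ _) => m' /= [m2' m1' _ _] e.
  by by_coordinates e.
- have := edge_box xy s01; move: (segment (pos x) _ _) => m /= [m2 m1 _ _] e.
  by by_coordinates e.
- have := edge_box xy s01; move: (segment (pos x) _ _) => m /= [m2 m1 _ _] e.
  by by_coordinates e.
- have := edge_box xy s01; move: (segment (pos x) _ _) => m /= [m2 m1 _ _] e.
  by by_coordinates e.
- have := edge_box xy' s01'; move: (segment (pos x') _ _) => m /= [m2 m1 m0 _] e.
  have [|xb mb] := m0; first by have [/= e1 e2] := pair_eq e; lra.
  by exists (High b); split; [right|left; rewrite xb|rewrite e mb /= pos_b].
- by move=> e; by_coordinates e.
- by move=> e; by_coordinates e.
- by move=> e; by_coordinates e.
- move=> /shrink_inj e.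
  have ne' : (x, y) <> (x', y') by move=> [h1 h2]; apply: ne; rewrite h1 h2.
  have [v [v1 v2 v3]] := straight_cross posP xy xy' ne' s01 s01' e.
  exists (High v); split; last by rewrite v3.
    by case: v1 => ->; [left|right].
  by case: v2 => ->; [left|right].
- have := edge_box xy s01; move: (segment (pos x) _ _) => m /= [m2 m1 _ m3] e.
  have [|yt mt] := m3; first by have [/= e1 e2] := pair_eq e; lra.
  by exists (High t); split; [right; rewrite yt|left|rewrite mt /= pos_t].
- have := edge_box xy s01; move: (segment (pos x) _ _) => m /= [m2 m1 _ _] e.
  by by_coordinates e.
- have := edge_box xy s01; move: (segment (pos x) _ _) => m /= [m2 m1 _ _] e.
  by by_coordinates e.
- by move=> e; by_coordinates e.
- move=> e; exists Top; split; [by right|by right|].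
  have [/= e1 e2] := pair_eq e; have -> : s = 1 by lra.
  by rewrite /segment /=; congr pair; ring.
- move=> e; exists Side; split; [by right|by left|].
  have [/= e1 e2] := pair_eq e; have -> : s = 1 by lra.
  by rewrite /segment /=; congr pair; ring.
Qed.

Lemma tower_drawing : straight_drawing tower_pos.
Proof.
split.
- case=> [|x|x||] [|y|y||] // e;
    try (by rewrite (straight_inj posP (shrink_inj e)));
    move: (pair_eq e) => [/= e1 e2]; clear e; exfalso;
    try move: (pos_x x) (pos_y x); try move: (pos_x y) (pos_y y); lra.
- move=> p q /(cover_tower b_min t_max)[|x y xy||x y xy|||];
    rewrite /= ?pos_b ?pos_t /=; try lra.
    by have := straight_up posP xy; lra.
  by have := straight_up posP xy; lra.
- have zx := pos_x; have zy := pos_y.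
  move=> p q v s /(cover_tower b_min t_max)[|x y xy||x y xy|||] s01;
    rewrite /= ?segment_shrink ?pos_b ?pos_t.
  + case: v => [|z|z||] e; try (by left); try (by move: (zx z) (zy z) => *; by_coordinates e);
      try by by_coordinates e.
    right; congr Low; apply: pos_y0; have [/= e1 e2] := pair_eq e; clear e; lra.
  + case: v => [|z|z||] e; last 2 first.
    * have := edge_box xy s01; move: (segment (pos x) _ _) e => m e /= [m2 m1 _ _].
      by by_coordinates e.
    * have := edge_box xy s01; move: (segment (pos x) _ _) e => m e /= [m2 m1 _ _].
      by by_coordinates e.
    * have := edge_box xy s01; move: (segment (pos x) _ _) e => m e /= [m2 m1 _ _].
      by by_coordinates e.
    * by case: (straight_vertex posP xy s01 (shrink_inj e)) => ->; [left|right].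
    have := edge_box xy s01; move: (segment (pos x) _ _) e => m e /= [m2 m1 _ _].
    by move: (zx z) (zy z) => *; by_coordinates e.
  + case: v => [|z|z||] e; try (by by_coordinates e).
      left; congr Low; apply: pos_y1; have [/= e1 e2] := pair_eq e; clear e; lra.
    right; congr High; apply: pos_y0; have [/= e1 e2] := pair_eq e; clear e; lra.
  + case: v => [|z|z||] e; last 2 first.
    * have := edge_box xy s01; move: (segment (pos x) _ _) e => m e /= [m2 m1 _ _].
      by by_coordinates e.
    * have := edge_box xy s01; move: (segment (pos x) _ _) e => m e /= [m2 m1 _ _].
      by by_coordinates e.
    * have := edge_box xy s01; move: (segment (pos x) _ _) e => m e /= [m2 m1 _ _].
      by by_coordinates e.
    * have := edge_box xy s01; move: (segment (pos x) _ _) e => m e /= [m2 m1 _ _].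
      by move: (zx z) (zy z) => *; by_coordinates e.
    by case: (straight_vertex posP xy s01 (shrink_inj e)) => ->; [left|right].
  + case: v => [|z|z||] e; try (by right); try (by by_coordinates e).
      by move: (zx z) (zy z) => *; by_coordinates e.
    left; congr High; apply: pos_y1; have [/= e1 e2] := pair_eq e; clear e; lra.
  + case: v => [|z|z||] e; try (by left); try (by right); try (by by_coordinates e).
      by move: (zx z) (zy z) => *; by_coordinates e.
    by move: (zx z) (zy z) => *; by_coordinates e.
  case: v => [|z|z||] e; try (by left); try (by right); try (by by_coordinates e).
    by move: (zx z) (zy z) => *; by_coordinates e.
  by move: (zx z) (zy z) => *; by_coordinates e.
move=> p q p' q' s s' /(cover_tower b_min t_max) c /(cover_tower b_min t_max) c' ne s01 s01' e.
have [h|/ltnW h] := leqP (cover_index p q) (cover_index p' q').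
  exact: (tower_cross c c' h ne s01 s01' e).
have [|v [v1 v2 v3]] := tower_cross c' c h _ s01' s01 (esym e); first by move=> ne'; apply: ne.
by exists v; rewrite e.
Qed.

Lemma tower_pos_x p : -1 < (tower_pos p).1 < 1.
Proof. by case: p => [|x|x||] /=; try have := pos_x x; lra. Qed.
End TowerDrawing.

Lemma has_rainbow_le (d : Order.disp_t) (T : finPOrderType d) (L : rel T) (m n : nat) :
  linear_extension L -> n <= m -> has_rainbow L m -> has_rainbow L n.
Proof.
move=> [_ anti tr _] nm [s [sm /andP[/allP cov srt]]].
exists (drop (m - n) s); split; first by rewrite size_drop sm subKn.
have sub : subseq (drop (m - n) s) s by apply: drop_subseq.
apply/andP; split; first by apply/allP => c /(mem_subseq sub)/cov.
have str : transitive (strict_rel L).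
  move=> q p r /andP[pq Lpq] /andP[qr Lqr]; rewrite /strict_rel (tr _ _ _ Lpq Lqr) andbT.
  by apply: contra_neq pq => epr; apply: anti; rewrite Lpq epr Lqr.
apply: subseq_sorted srt => //; apply: cat_subseq; first exact: map_subseq.
by rewrite subseq_rev; apply: map_subseq.
Qed.

Lemma queue_number_ge (d : Order.disp_t) (T : finPOrderType d) (w : nat) :
  (forall L : rel T, linear_extension L -> has_rainbow L w) -> w <= queue_number T.
Proof.
move=> rb; rewrite /queue_number; case: ex_minnP => k /asboolP[L [Lext nr]] _.
rewrite leqNgt; apply/negP => kw; apply: nr.
exact: has_rainbow_le Lext kw (rb L Lext).
Qed.

Section Towers.
Variable R : realType.
Local Open Scope ring_scope.

(** The invariant of the iteration: besides the drawing it keeps the ends at fixed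
    places and the drawing in a strip, as [tower_pos] requires. *)
Record tall_tower (d : Order.disp_t) (T : finPOrderType d) (b t : T)
    (pos : T -> R * R) (w : nat) : Prop := TallTower {
  tower_bot : forall x, (b <= x)%O;
  tower_top : forall x, (x <= t)%O;
  tower_width : (width T <= w)%N;
  tower_forced : forall L : rel T, linear_extension L -> has_rainbow L w;
  tower_straight : straight_drawing pos;
  tower_pos_bot : pos b = (0, 0);
  tower_pos_top : pos t = (0, 1);
  tower_pos_strip : forall x, -1 < (pos x).1 < 1 }.

Lemma bool_tower : tall_tower false true (fun x : bool => (0, if x then 1 else 0)) 1.
Proof.
have cov (x y : bool) : cover_rel x y -> x = false /\ y = true.
  by case: x y => -[] /andP[].
split=> //.
- by case.
- apply/bigop.bigmax_leqP => A hA; apply/card_le1_eqP => x y xA yA.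
  apply/eqP; apply: contraT => xy; move: hA => /forall_inP/(_ x xA)/forall_inP/(_ y yA).
  by rewrite eq_sym xy /= comparableT.
- move=> L [_ _ _ ext]; exists [:: (false, true)]; split=> //.
  rewrite /is_rainbow /= !andbT; apply/andP; split; last exact: ext.
  by rewrite /cover_rel /=; apply/existsPn => -[].
- split.
  + by move=> [] [] // [] /eqP; rewrite ?oner_eq0 // eq_sym oner_eq0.
  + by move=> a b /cov[-> ->] /=; apply: ltr01.
  + by move=> a b v s /cov[-> ->] _ _; case: v; [right|left].
  by move=> a b a' b' s s' /cov[-> ->] /cov[-> ->].
- by move=> x /=; rewrite ltrN10 ltr01.
Qed.

Lemma tower_tower (d : Order.disp_t) (T : finPOrderType d) b t pos w :
  @tall_tower d T b t pos w -> tall_tower (Bot : tower T) Top (tower_pos pos) w.+1.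
Proof.
case=> bP tP wP fP sP pb pt px; split=> //.
- by case.
- by apply/bigop.bigmax_leqP => A; apply: tower_antichain.
- exact: (tower_rainbow bP tP).
- exact: (tower_drawing bP tP).
- exact: tower_pos_x.
Qed.

Lemma tall_tower_exists (w : nat) : exists d (T : finPOrderType d) b t pos,
  @tall_tower d T b t pos w.+1.
Proof.
elim: w => [|w [d [T [b [t [pos h]]]]]].
  by exists _, bool, false, true; eexists; apply: bool_tower.
by exists d, (tower T), Bot, Top; eexists; apply: tower_tower h.
Qed.

Lemma tall_tower_queue_number (d : Order.disp_t) (T : finPOrderType d) b t pos w :
  @tall_tower d T b t pos w ->
  [/\ (0 < #|T|)%N, planar R T, width T = w & queue_number T = w].
Proof.
case=> bP tP wP fP sP pb pt px.
have pl : planar R T := straight_planar sP.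
have minb : minimals T \subset [set b]%SET.
  apply/fintype.subsetP => x; rewrite !inE => /forallP/(_ b).
  by have := bP x; rewrite le_eqVlt => /predU1P[->|->]; rewrite ?eqxx.
have maxt : maximals T \subset [set t]%SET.
  apply/fintype.subsetP => x; rewrite !inE => /forallP/(_ t).
  by have := tP x; rewrite le_eqVlt => /predU1P[->|->]; rewrite ?eqxx.
have qw : (queue_number T <= width T)%N.
  have := planar_queue_number b pl; move: (subset_leq_card minb) (subset_leq_card maxt).
  by rewrite !cards1; lia.
have wq := queue_number_ge fP.
have e : width T = w by apply/eqP; rewrite eqn_leq wP (leq_trans wq qw).
split=> //; first by apply/card_gt0P; exists b.
by apply/eqP; rewrite eqn_leq wq -e qw.
Qed.
End Towers.

Theorem theorem1 (R : realType) :
  (forall w : nat, (1 <= w)%N ->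
     forall (d : Order.disp_t) (T : finPOrderType d),
       (0 < #|T|)%N -> planar R T -> width T = w ->
       (queue_number T <= 3 * w - 2)%N) /\
  (forall w : nat, (1 <= w)%N ->
     exists (d : Order.disp_t) (T : finPOrderType d),
       [/\ (0 < #|T|)%N, planar R T, width T = w & queue_number T = w]).
Proof.
split=> [w w1 d T /card_gt0P[x _] pl wT|[//|w] _].
  apply: leq_trans (planar_queue_number x pl) _.
  by have := minimals_width T; have := maximals_width T; lia.
have [d [T [b [t [pos h]]]]] := tall_tower_exists R w.
by exists d, T; apply: tall_tower_queue_number h.
Qed.
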